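(* Consider an arbitrary quantum prover-verifier interaction between a verifier Alice and a prover Bob (as described in the context), and let $p$ denote the optimal probability, over all strategies of Bob, that Bob obtains the winning outcome in a single instance. Consider $n$ parallel instances of this interaction. Let $\delta > 0$ be a positive constant and let $k \in \mathbb{N}$ satisfy $k = n(p+\delta)$. Then, for every strategy of Bob in the $n$ parallel instances, the probability that Bob obtains the winning outcome in at least $k$ of the $n$ instances is at most $e^{-2n\delta^2}$.
   Context: A quantum prover-verifier interaction with $r$ rounds is specified by: finite-dimensional Hilbert spaces $\mathcal{X}_1,\ldots,\mathcal{X}_r$ (Alice-to-Bob messages), $\mathcal{Y}_1,\ldots,\mathcal{Y}_r$ (Bob-to-Alice messages), and $\mathcal{Z}_1,\ldots,\mathcal{Z}_r$ (Alice's private memory after each of her messages); a density operator $\rho$ on $\mathcal{X}_1\otimes\mathcal{Z}_1$ (Alice's first message together with her memory); quantum channels $\Psi_2,\ldots,\Psi_r$, where $\Psi_i$ maps density operators on $\mathcal{Y}_{i-1}\otimes\mathcal{Z}_{i-1}$ to density operators on $\mathcal{X}_i\otimes\mathcal{Z}_i$ (Alice's response and updated memory); and a binary POVM $\{P_0,P_1\}$ on $\mathcal{Y}_r\otimes\mathcal{Z}_r$, where outcome $1$ is the winning outcome for Bob and $0$ the losing outcome. Alice's actions are fixed; Bob may choose any sequence of quantum channels, with arbitrary finite-dimensional private memory, mapping each received message (and his memory) to his reply (and updated memory). In $n$ parallel instances, Alice runs $n$ independent identical copies of her actions (each with its own memory and final measurement), while Bob receives all $n$ messages of each round jointly and may apply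 arbitrary quantum channels acting jointly on all of them and his memory, so his replies may be entangled across instances. Bob wins instance $i$ if the final measurement of instance $i$ yields outcome $1$. *)

(* Defs.v *)
From HB Require Import structures.
From mathcomp Require Import all_boot all_order all_algebra.
From mathcomp Require Import sesquilinear spectral.
From mathcomp Require Import complex.
From mathcomp Require Import mathcomp_extra boolp classical_sets functions reals.

Set Implicit Arguments.
Unset Strict Implicit.
Unset Printing Implicit Defensive.

Import Order.TTheory GRing.Theory Num.Theory.
Local Open Scope ring_scope.
Local Open Scope sesquilinear_scope.

(* A finite-dimensional Hilbert space is C^T for a finite type T labelling an
   orthonormal basis. The tensor product of the spaces labelled by S and T is
   labelled by S * T, and the n-fold tensor power by {ffun 'I_n -> T}. *)
Notation Op R T := 'M[R[i]]_(#|{: T}|).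
Notation superop R S T := (Op R S -> Op R T).

Section Operators.
Variable R : realType.
Implicit Types S T U W : finType.

Definition entry T (A : Op R T) (t t' : T) : R[i] :=
  A (enum_rank t) (enum_rank t').

Definition mkop T (f : T -> T -> R[i]) : Op R T :=
  \matrix_(i, j) f (enum_val i) (enum_val j).

(* The operator |t><t'|. *)
Definition unitop T (t t' : T) : Op R T :=
  delta_mx (enum_rank t) (enum_rank t').

(* In the order of R[i], 0 <= z means that z is real and nonnegative. *)
Definition psd T (A : Op R T) : Prop :=
  forall v : 'cV[R[i]]_(#|{: T}|), 0 <= (v^t* *m A *m v) ord0 ord0.

Definition density T (A : Op R T) : Prop := psd A /\ \tr A = 1.

Definition povm (O : finType) T (P : O -> Op R T) : Prop :=
  (forall o, psd (P o)) /\ \sum_o P o = 1%:M.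

Definition tensop S T (A : Op R S) (B : Op R T) : Op R (S * T) :=
  mkop (fun u u' => entry A u.1 u'.1 * entry B u.2 u'.2).

(* F tensored with the identity on the operators on the space labelled by W:
   F is applied to each of the blocks (1 (x) <w|) A (1 (x) |w'>). *)
Definition superop_ext S T (F : superop R S T) W :
    superop R (S * W) (T * W) :=
  fun A => mkop (fun u u' =>
    entry (F (mkop (fun s s' => entry A (s, u.2) (s', u'.2)))) u.1 u'.1).

Definition completely_positive S T (F : superop R S T) : Prop :=
  forall W (A : Op R (S * W)), psd A -> psd (superop_ext F A).

Definition trace_preserving S T (F : superop R S T) : Prop :=
  forall A, \tr (F A) = \tr A.

Definition channel S T (F : superop R S T) : Prop :=
  [/\ linear F, completely_positive F & trace_preserving F].

(* Exchanges the second and third tensor factors. *)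
Definition swap23 S T U (A : Op R (S * T * U)) : Op R (S * U * T) :=
  mkop (fun u u' =>
    entry A (u.1.1, u.2, u.1.2) (u'.1.1, u'.2, u'.1.2)).

Definition instance n S T (i : 'I_n)
    (u : {ffun 'I_n -> S} * {ffun 'I_n -> T}) : S * T := (u.1 i, u.2 i).

(* The tensor product of n operators on the space labelled by S * T, with the n
   factors labelled by S grouped together, and those labelled by T too. *)
Definition op_prod n S T (A : 'I_n -> Op R (S * T)) :
    Op R ({ffun 'I_n -> S} * {ffun 'I_n -> T}) :=
  mkop (fun u u' => \prod_(i < n) entry (A i) (instance i u) (instance i u')).

(* The n-fold tensor power of a linear F, with the same grouping of the factors:
   it sends the tensor product of the |v_i><v'_i| to that of the
   F(|v_i><v'_i|). *)
Definition superop_pow n S T U W (F : superop R (S * T) (U * W)) :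
    superop R ({ffun 'I_n -> S} * {ffun 'I_n -> T})
              ({ffun 'I_n -> U} * {ffun 'I_n -> W}) :=
  fun A => mkop (fun u u' => \sum_v \sum_v' entry A v v' *
    \prod_(i < n) entry (F (unitop (instance i v) (instance i v')))
                        (instance i u) (instance i u')).

End Operators.

(* Rounds are numbered from 0, so there are last_round.+1 of them, at least one.
   [resp G i] is Alice's action between rounds i and i.+1; the components of the
   families at indices outside these ranges are never used nor constrained.
   Alice's final measurement has outcomes in O: this is bool for a single
   instance, with true the winning outcome, and {ffun 'I_n -> bool} for n
   parallel instances. *)
Record interaction (R : realType) (O : finType) := Interaction {
  last_round : nat;
  amsg : nat -> finType;
  bmsg : nat -> finType;
  amem : nat -> finType;
  first_msg : Op R (amsg 0 * amem 0);
  resp : forall i,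
    superop R (bmsg i * amem i) (amsg i.+1 * amem i.+1);
  meas : O -> Op R (bmsg last_round * amem last_round)
}.

Arguments resp {R O} _ _ _.

Definition valid_interaction (R : realType) (O : finType)
    (G : interaction R O) : Prop :=
  [/\ density (first_msg G),
      forall i, (i < last_round G)%N -> channel (resp G i)
    & povm (meas G)].

Definition parallel (R : realType) (O : finType) (n : nat)
    (G : interaction R O) : interaction R {ffun 'I_n -> O} :=
  {| last_round := last_round G;
     amsg := fun i => {ffun 'I_n -> amsg G i};
     bmsg := fun i => {ffun 'I_n -> bmsg G i};
     amem := fun i => {ffun 'I_n -> amem G i};
     first_msg := op_prod (fun _ : 'I_n => first_msg G);
     resp := fun i => superop_pow (n := n) (resp G i);
     meas := fun o : {ffun 'I_n -> O} => op_prod (fun i => meas G (o i)) |}.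

Record strategy (R : realType) (O : finType) (G : interaction R O) := Strategy {
  bmem : nat -> finType;
  bob_init : Op R (bmem 0);
  bob_act : forall i, superop R (amsg G i * bmem i) (bmsg G i * bmem i.+1);
  bob_init_density : density bob_init;
  bob_act_channel : forall i, (i <= last_round G)%N -> channel (@bob_act i)
}.

Arguments bob_act {R O G} _ _ _.

Section Run.
Variables (R : realType) (O : finType) (G : interaction R O) (B : strategy G).

Definition bob_step i (A : Op R (amsg G i * amem G i * bmem B i)) :
    Op R (bmsg G i * amem G i * bmem B i.+1) :=
  swap23 (superop_ext (bob_act B i) (swap23 A)).

(* The joint state just before Bob's action in round i. *)
Fixpoint joint_state i : Op R (amsg G i * amem G i * bmem B i) :=
  match i with
  | 0 => tensop (first_msg G) (bob_init B)
  | j.+1 => superop_ext (resp G j) (bob_step (joint_state j))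
  end.

Definition final_state := bob_step (joint_state (last_round G)).

Definition outcome_prob (o : O) : R :=
  complex.Re (\tr (tensop (meas G o) 1%:M *m final_state)).

End Run.

Definition optimal_win_prob (R : realType) (G : interaction R bool) : R :=
  sup [set q | exists B : strategy G, q = outcome_prob B true]%classic.

Definition prob_at_least_wins (R : realType) (n : nat)
    (G : interaction R bool) (B : strategy (parallel n G)) (k : nat) : R :=
  \sum_(o : {ffun 'I_n -> bool} | (k <= #|[set i | o i]|)%N) outcome_prob B o.

(* Main.v *)
Require Import Defs.
From mathcomp Require Import all_boot all_order all_algebra.
From mathcomp Require Import sesquilinear spectral complex.
From mathcomp Require Import boolp classical_sets reals normedtype derive realfun.
From mathcomp Require Import sequences exp ring lra.

Set Implicit Arguments.
Unset Strict Implicit.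
Unset Printing Implicit Defensive.

Import Order.TTheory GRing.Theory Num.Theory.
Import numFieldNormedType.Exports.
Local Open Scope ring_scope.
Local Open Scope sesquilinear_scope.

(** A strategy of Bob is described by positive operators J_0 = 1, J_1, ...,
    where J_i acts on the messages of the first i rounds and
    tr_{Y_i} J_{i+1} = J_i (x) 1_{X_i}; the probability of an outcome is the
    pairing of the last of them with a positive operator that depends on Alice
    only.  Conversely such a sequence of positive definite operators
    J_i = A_i^* A_i is realized by isometries |x> A_i|h> |-> sum_y |y> A_{i+1}|h,x,y>,
    and positive definite sequences are dense, by mixing with uniformly random
    answers.

    Maximizing the payoff F := P_0 + w P_1 over strategies is therefore a
    semidefinite program.  Its dual asks for operators Q_i with
    F <= Q_r (x) 1_{Y_r}, tr_{X_r} Q_r <= Q_{r-1} (x) 1_{Y_{r-1}}, ..., of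
    value tr Q_0.  By Hahn-Banach there is no duality gap, so there are dual
    solutions with value arbitrarily close to 1 - p + p w.  When w >= 0 all these
    operators are positive, hence the tensor powers of a dual solution are a
    dual solution for n parallel instances, and weak duality yields
    E[w^wins] <= (1 - p + p w)^n.  Hoeffding's bound on 1 - p + p e^t, taken at
    t = 4 delta, and Markov's inequality conclude. *)

(** * Positive operators *)

Section Positivity.
Variable R : realType.
Implicit Types S T : finType.
Local Notation C := R[i].

(** Operators as kernels on the basis labels themselves; [entry] and [mkop] pass back and forth to
    [Op], so later sums run over labels rather than ordinals. *)
Definition fop T := T -> T -> C.

Lemma entry_mkop T (f : fop T) : entry (mkop f) = f.
Proof.
by apply/funext => t; apply/funext => t'; rewrite /entry /mkop mxE !enum_rankK.
Qed.

Lemma mkop_entry T (A : Op R T) : mkop (entry A) = A.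
Proof. by apply/matrixP => i j; rewrite /entry /mkop mxE !enum_valK. Qed.

Lemma sum_enum_val T (V : nmodType) (F : 'I_#|{: T}| -> V) :
  \sum_i F i = \sum_t F (enum_rank t).
Proof. by rewrite (reindex _ (onW_bij _ (@enum_rank_bij T))). Qed.

Lemma tr_entry T (A : Op R T) : \tr A = \sum_t entry A t t.
Proof. by rewrite /mxtrace sum_enum_val. Qed.

Lemma tr_mulop T (A B : Op R T) :
  \tr (A *m B) = \sum_t \sum_t' entry A t t' * entry B t' t.
Proof.
by rewrite /mxtrace sum_enum_val; apply: eq_bigr => t _; rewrite mxE sum_enum_val.
Qed.

Definition quad T (f : fop T) (v : T -> C) : C :=
  \sum_t \sum_t' (v t)^* * f t t' * v t'.

Definition pos T (f : fop T) := forall v, 0 <= quad f v.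

(** A sum of rank-one terms [|a_k><a_k|], which by [gram_pos] and [pos_gram] is the same as
    positivity. Products, partial traces and reindexings act directly on the vectors [a_k]. *)
Definition gram T (f : fop T) := exists (K : finType) (a : K -> T -> C),
  forall t t', f t t' = \sum_k a k t * (a k t')^*.

Lemma quadE T (f : fop T) (v : 'cV[C]_(#|{: T}|)) :
  (v^t* *m mkop f *m v) ord0 ord0 = quad f (fun t => v (enum_rank t) ord0).
Proof.
rewrite mxE sum_enum_val /quad exchange_big /=; apply: eq_bigr => t' _.
rewrite mxE sum_enum_val mulr_suml; apply: eq_bigr => t _.
by rewrite !mxE !enum_rankK.
Qed.

Lemma psdE T (A : Op R T) : psd A <-> pos (entry A).
Proof.
split=> hA v; last by rewrite -(mkop_entry A) quadE.
have := hA (\col_i v (enum_val i)); rewrite -{1}(mkop_entry A) quadE.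
by under eq_fun do rewrite mxE enum_rankK.
Qed.

Lemma psd_mkop T (f : fop T) : psd (mkop f) <-> pos f.
Proof. by rewrite psdE entry_mkop. Qed.

Lemma sum_delta_l T (F : T -> C) t : \sum_t' (t' == t)%:R * F t' = F t.
Proof.
rewrite (bigD1 t) //= eqxx mul1r big1 ?addr0 // => t' /negPf ->.
by rewrite mul0r.
Qed.

Lemma sum_delta_r T (F : T -> C) t : \sum_t' F t' * (t' == t)%:R = F t.
Proof. by under eq_bigr do rewrite mulrC; apply: sum_delta_l. Qed.

Lemma gram_pos T (f : fop T) : gram f -> pos f.
Proof.
move=> [K [a fE]] v.
suff -> : quad f v = \sum_k (\sum_t (v t)^* * a k t) * (\sum_t (v t)^* * a k t)^*.
  by apply: sumr_ge0 => k _; apply: mul_conjC_ge0.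
rewrite /quad.
under [RHS]eq_bigr => k _.
  rewrite rmorph_sum big_distrlr /=.
  over.
rewrite [RHS]exchange_big /=; apply: eq_bigr => t _.
rewrite [RHS]exchange_big /=; apply: eq_bigr => t' _.
rewrite fE mulr_sumr mulr_suml; apply: eq_bigr => k _.
by rewrite rmorphM /= conjCK -!mulrA; congr (_ * (_ * _)); rewrite mulrC.
Qed.

Lemma quad_delta2 T (f : fop T) t t' c :
  quad f (fun s => (s == t)%:R + c * (s == t')%:R) =
  f t t + c * f t t' + c^* * f t' t + c^* * c * f t' t'.
Proof.
have inner s : \sum_s' f s s' * ((s' == t)%:R + c * (s' == t')%:R) =
    f s t + c * f s t'.
  under eq_bigr do rewrite mulrDr mulrCA.
  by rewrite big_split /= -mulr_sumr !sum_delta_r.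
rewrite /quad; under eq_bigr => s _.
  under eq_bigr do rewrite -mulrA.
  rewrite -mulr_sumr inner rmorphD rmorphM /= !conjC_nat mulrDl -mulrA.
  over.
rewrite big_split /= -mulr_sumr !sum_delta_l.
by rewrite mulrDr !addrA mulrA.
Qed.

(** On the test vectors [e_t + c e_t'] the quadratic form is real. Taking [c = 1] and [c = i]
    determines the off-diagonal entries up to conjugation. *)
Lemma pos_herm T (f : fop T) : pos f -> forall t t', f t' t = (f t t')^*.
Proof.
move=> hf t t'.
have d s : 0 <= f s s.
  have := hf (fun r => (r == s)%:R + 0 * (r == s)%:R).
  by rewrite quad_delta2 conjC0 !mul0r !addr0.
have h c : c * f t t' + c^* * f t' t \is Num.real.
  have := hf (fun r => (r == t)%:R + c * (r == t')%:R).
  rewrite quad_delta2 => /ger0_real H.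
  have -> : c * f t t' + c^* * f t' t =
    (f t t + c * f t t' + c^* * f t' t + c^* * c * f t' t') - f t t
     - c^* * c * f t' t' by ring.
  rewrite rpredB ?rpredB //; first exact: ger0_real.
  rewrite rpredM //; last exact: ger0_real.
  by apply: ger0_real; rewrite mulrC mul_conjC_ge0.
have h1 := h 1; have h2 := h 'i; move: h1 h2.
rewrite conjC1 conjCi !mul1r => /CrealP; rewrite rmorphD /= => h1.
move=> /CrealP; rewrite rmorphD !rmorphM rmorphN /= conjCi opprK => h2.
have h3 : 'i * ((f t' t)^* - (f t t')^*) = 'i * (f t t' - f t' t).
  by rewrite !mulrBr addrC -mulNr h2 mulNr.
have {h2}h3 := mulfI (neq0Ci _) h3.
have : 2 * f t' t = 2 * (f t t')^*.
  have -> : 2 * f t' t = (f t t' + f t' t) - (f t t' - f t' t) by ring.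
  by rewrite -h1 -h3; ring.
by apply: mulfI; rewrite pnatr_eq0.
Qed.

(** The eigenvectors are the conjugated rows of the unitary [P]. Writing each eigenvalue as the form
    evaluated at its eigenvector lets positivity, or strict positivity, of [f] pass to [D]. *)
Lemma pos_spectral T (f : fop T) : pos f ->
  exists (P : T -> T -> C) (D : T -> C),
  [/\ forall k, D k = quad f (fun t => (P k t)^*),
      forall t t', f t t' = \sum_k D k * (P k t)^* * P k t',
      forall k k', \sum_t P k t * (P k' t)^* = (k == k')%:R
    & forall t t', \sum_k (P k t)^* * P k t' = (t == t')%:R].
Proof.
move=> hf; set A := mkop f.
have hA : A \is hermsymmx.
  apply/is_hermitianmxP/matrixP => i j; rewrite expr0 scale1r !mxE.
  by rewrite -(pos_herm hf).
have /orthomx_spectralP := hermitian_normalmx hA.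
have hP := spectral_unitarymx A; rewrite (invmx_unitary hP).
set P := spectralmx A in hP *; set D := spectral_diag A => AE.
have PP : P *m P^t* = 1%:M by apply/unitarymxP.
have PP' : P^t* *m P = 1%:M by apply/mulmx1C.
have delta_rank (k k' : T) : (1%:M : Op R T) (enum_rank k) (enum_rank k') = (k == k')%:R.
  by rewrite mxE (inj_eq enum_rank_inj).
exists (fun k t => P (enum_rank k) (enum_rank t)), (fun k => D ord0 (enum_rank k)).
split=> [k|t t'|k k'|t t'].
- have DE : P *m A *m P^t* = diag_mx D.
    by rewrite AE !mulmxA PP mul1mx -mulmxA PP mulmx1.
  have -> : (fun t => (P (enum_rank k) (enum_rank t))^*) =
      (fun t => ((row (enum_rank k) P)^t*) (enum_rank t) ord0).
    by apply/funext => t; rewrite !mxE.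
  rewrite -quadE trmxCK -/A -row_mul.
  move/matrixP: DE => /(_ (enum_rank k) (enum_rank k)).
  rewrite [in X in _ = X -> _]mxE eqxx mulr1n => <-.
  by rewrite !mxE; apply: eq_bigr => j _; rewrite !mxE.
- rewrite -{1}(entry_mkop f) /entry -/A AE mxE sum_enum_val.
  apply: eq_bigr => k _; rewrite mxE (bigD1 (enum_rank k)) //= big1; last first.
    by move=> j /negPf jk; rewrite [diag_mx _ _ _]mxE jk mulr0n mulr0.
  by rewrite addr0 !mxE eqxx mulr1n; congr (_ * _); rewrite mulrC.
- rewrite -delta_rank -PP mxE sum_enum_val.
  by apply: eq_bigr => t _; rewrite !mxE.
- rewrite -delta_rank -PP' mxE sum_enum_val.
  by apply: eq_bigr => k _; rewrite !mxE.
Qed.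

Lemma pos_gram T (f : fop T) : pos f -> gram f.
Proof.
move=> hf; have [P [D [DE fE _ _]]] := pos_spectral hf.
exists T, (fun k t => sqrtC (D k) * (P k t)^*) => t t'.
rewrite fE; apply: eq_bigr => k _.
have D0 : 0 <= D k by rewrite DE; apply: hf.
rewrite rmorphM /= conjCK mulrACA.
rewrite (_ : (sqrtC (D k))^* = sqrtC (D k)); last first.
  by apply: CrealP; apply: ger0_real; rewrite sqrtC_ge0.
by rewrite -expr2 sqrtCK mulrA.
Qed.

Definition pdef T (f : fop T) := forall v, (exists t, v t != 0) -> 0 < quad f v.

Lemma pdef_pos T (f : fop T) : pdef f -> pos f.
Proof.
move=> hf v; have [/hf /ltW //|v0] := pselect (exists t, v t != 0).
rewrite /quad big1 // => t _; rewrite big1 // => t' _.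
have -> : v t' = 0 by apply: contrapT => /eqP ?; apply: v0; exists t'.
by rewrite mulr0.
Qed.

(** The eigenvalues are positive, so the square-root factor [a] has a two-sided inverse [b]; this
    inverse later defines Bob's isometries. *)
Lemma pdef_factor T (f : fop T) : pdef f -> exists a b : T -> T -> C,
  [/\ forall t t', f t t' = \sum_k a k t * (a k t')^*,
      forall t t', \sum_k b t k * a k t' = (t == t')%:R
    & forall k k', \sum_t a k t * b t k' = (k == k')%:R].
Proof.
move=> hf; have [P [D [DE fE PP PP']]] := pos_spectral (pdef_pos hf).
have D0 k : 0 < D k.
  rewrite DE; apply: hf; apply: contrapT => h.
  have := PP k k; rewrite eqxx big1 => [/eqP|t _]; first by rewrite eq_sym oner_eq0.
  have -> : (P k t)^* = 0 by apply: contrapT => /eqP ?; apply: h; exists t.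
  by rewrite mulr0.
have s0 k : sqrtC (D k) != 0 by rewrite sqrtC_eq0 gt_eqF.
exists (fun k t => sqrtC (D k) * (P k t)^*), (fun t k => P k t / sqrtC (D k)).
split=> [t t'|t t'|k k'].
- rewrite fE; apply: eq_bigr => k _.
  rewrite rmorphM /= conjCK mulrACA (_ : (sqrtC (D k))^* = sqrtC (D k)); last first.
    by apply: CrealP; apply: ger0_real; rewrite sqrtC_ge0 ltW.
  by rewrite -expr2 sqrtCK mulrA.
- rewrite eq_sym -PP'; apply: eq_bigr => k _.
  by rewrite mulrA mulfVK // mulrC.
- transitivity ((sqrtC (D k) / sqrtC (D k')) * \sum_t P k' t * (P k t)^*).
    by rewrite mulr_sumr; apply: eq_bigr => t _; ring.
  by rewrite PP eq_sym; case: eqP => [->|_]; rewrite ?mulr0 // mulr1 divff.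
Qed.

End Positivity.

(** * Sublinear functionals *)

Section HahnBanach.
Variables (R : realType) (V : lmodType R).
Implicit Types (p q : V -> R) (x y : V).

Definition sublinear p := (forall x y, p (x + y) <= p x + p y) /\
  (forall c x, 0 <= c -> p (c *: x) <= c * p x).

Lemma sublinear0 p : sublinear p -> p 0 = 0.
Proof.
move=> [pD pZ]; have := pZ 0 0 (lexx 0); rewrite scale0r mul0r => p0.
by apply/le_anti; rewrite p0 /=; have := pD 0 0; rewrite addr0 -lerBlDl subrr.
Qed.

Lemma sublinearN p : sublinear p -> forall x, - p x <= p (- x).
Proof.
move=> hp x; have [pD _] := hp; have := pD x (- x).
by rewrite subrr (sublinear0 hp) -lerBlDl sub0r.
Qed.

Section FlatAlong.
Variables (p : V -> R) (hp : sublinear p) (x : V).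

Let vals y : set R := [set r | exists2 t, 0 <= t & r = p (y + t *: x) - t * p x]%classic.

(* The largest sublinear minorant of [p] with value at most [- p x] at [- x]. *)
Definition flat_along y := inf (vals y).

Let lbvals y : lbound (vals y) (- p (- y)).
Proof.
move=> _ [t t0 ->]; have [pD pZ] := hp.
have := pD (y + t *: x) (- y); rewrite addrAC subrr add0r => h1.
have h2 : t * p x <= p (t *: x).
  have [->|t1] := eqVneq t 0; first by rewrite mul0r scale0r sublinear0.
  (* Scaling back by [t^-1] turns the one-sided homogeneity into its reverse. *)
  have := pZ t^-1 (t *: x); rewrite invr_ge0 => /(_ t0).
  by rewrite scalerA mulVf // scale1r mulrC ler_pdivlMr ?lt0r ?t1 // mulrC.
lra.
Qed.

Let has_inf_vals y : has_inf (vals y).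
Proof.
split; last by exists (- p (- y)); apply: lbvals.
by exists (p (y + 0 *: x) - 0 * p x), 0.
Qed.

Lemma flat_along_le y t : 0 <= t -> flat_along y <= p (y + t *: x) - t * p x.
Proof. by move=> t0; apply: ge_inf; [case: (has_inf_vals y)|exists t]. Qed.

Lemma le_flat_along y c :
  (forall t, 0 <= t -> c <= p (y + t *: x) - t * p x) -> c <= flat_along y.
Proof.
move=> h; apply: lb_le_inf; first by case: (has_inf_vals y).
by move=> _ [t t0 ->]; apply: h.
Qed.

Lemma flat_along_minorant y : flat_along y <= p y.
Proof. by have := flat_along_le y (lexx 0); rewrite scale0r mul0r addr0 subr0. Qed.

Lemma flat_alongN : flat_along (- x) <= - p x.
Proof.
have := flat_along_le (- x) ler01.
by rewrite scale1r mul1r addNr (sublinear0 hp) sub0r.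
Qed.

Lemma flat_along_sublinear : sublinear flat_along.
Proof.
have [pD pZ] := hp; split=> [y z|c y c0].
  rewrite -lerBlDr; apply: le_flat_along => t t0.
  rewrite lerBlDr -lerBlDl; apply: le_flat_along => s s0.
  rewrite lerBlDl; apply: le_trans (flat_along_le _ (addr_ge0 t0 s0)) _.
  have := pD (y + t *: x) (z + s *: x); rewrite addrACA -scalerDl => h; lra.
have [->|c1] := eqVneq c 0.
  rewrite scale0r mul0r; apply: le_trans (flat_along_minorant _) _.
  by rewrite sublinear0.
have cp : 0 < c by rewrite lt0r c1.
rewrite -ler_pdivrMl //; apply: le_flat_along => t t0.
rewrite ler_pdivrMl //; apply: le_trans (flat_along_le _ (mulr_ge0 c0 t0)) _.
by rewrite -scalerA -scalerDr; have := pZ c (y + t *: x) c0; lra.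
Qed.

End FlatAlong.

(** Flatten along one vector after another. A further minorant [q] keeps the flatness already won,
    because [q (- x) <= - p x <= - q x]. *)
Lemma flat_along_seq p (s : seq V) : sublinear p -> exists q,
  [/\ sublinear q, forall x, q x <= p x & forall x, x \in s -> q (- x) <= - q x].
Proof.
elim: s p => [|x s IH] p hp; first by exists p.
have [q [hq qp qs]] := IH _ (flat_along_sublinear hp x).
exists q; split=> // [y|y]; first exact: le_trans (qp y) (flat_along_minorant hp x y).
rewrite inE => /orP[/eqP ->|/qs //].
apply: le_trans (qp _) (le_trans (flat_alongN hp x) _).
by rewrite lerN2 (le_trans (qp _)) // flat_along_minorant.
Qed.

End HahnBanach.

(** Hahn-Banach in finite dimension: flattening along [x] first forces contact with [p] at [x], and
    flattening along the standard basis then makes the minorant linear. *)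
Lemma sublinear_support (R : realType) (I : finType)
    (p : {ffun I -> R^o} -> R) (x : {ffun I -> R^o}) : sublinear p ->
  exists l : I -> R, (forall g : {ffun I -> R^o}, \sum_i g i * l i <= p g) /\
    p x <= \sum_i x i * l i.
Proof.
move=> hp; pose e i : {ffun I -> R^o} := [ffun j => (j == i)%:R].
have hq0 := flat_along_sublinear hp x.
have [q [hq qp qe]] := flat_along_seq [seq e i | i <- enum I] hq0.
have [qD qZ] := hq.
have qN i : q (- e i) = - q (e i).
  apply/le_anti; rewrite sublinearN // qe //.
  by apply/mapP; exists i; rewrite ?mem_enum.
have qZe i c : q (c *: e i) <= c * q (e i).
  have [c0|/ltW c0] := leP 0 c; first exact: qZ.
  have := qZ (- c) (- e i); rewrite oppr_ge0 => /(_ c0).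
  by rewrite scalerN scaleNr opprK qN mulrNN.
have qsum (g : {ffun I -> R^o}) : q g <= \sum_i g i * q (e i).
  rewrite {1}(_ : g = \sum_i g i *: e i); last first.
    apply/ffunP => j; rewrite sum_ffunE (bigD1 j) //= big1 => [|i /negPf ij].
      by rewrite addr0 !ffunE eqxx /GRing.scale /= mulr1.
    by rewrite !ffunE eq_sym ij /GRing.scale /= mulr0.
  elim/big_ind2 : _ => [|a b a' b' h1 h2|i _]; first by rewrite sublinear0.
    by apply: le_trans (qD _ _) _; apply: lerD.
  exact: qZe.
have qlin (g : {ffun I -> R^o}) : \sum_i g i * q (e i) <= q g.
  have := qsum (- g); have := sublinearN hq g.
  have -> : \sum_i (- g) i * q (e i) = - \sum_i g i * q (e i).
    by rewrite -sumrN; apply: eq_bigr => i _; rewrite ffunE mulNr.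
  lra.
exists (fun i => q (e i)); split=> [g|].
  exact: le_trans (qlin g) (le_trans (qp g) (flat_along_minorant hp x g)).
apply: le_trans (qsum x).
have := le_trans (sublinearN hq x) (le_trans (qp (- x)) (flat_alongN hp x)).
by rewrite lerN2.
Qed.

(** * Bilinear pairing of operators and partial traces *)

Section Pairing.
Variable R : realType.
Local Notation C := R[i].
Local Notation Re := complex.Re.
Local Notation Im := complex.Im.
Implicit Types S T H X Y : finType.

Lemma ReD (x y : C) : Re (x + y) = Re x + Re y.
Proof. by case: x; case: y. Qed.

Lemma ReZ (a : R) (x : C) : Re (a%:C%C * x) = a * Re x.
Proof. by case: x => u w /=; rewrite mul0r subr0. Qed.

Lemma Re_sum (I : Type) (r : seq I) (P : pred I) (F : I -> C) :
  Re (\sum_(i <- r | P i) F i) = \sum_(i <- r | P i) Re (F i).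
Proof. by elim/big_rec2: _ => // i x y _ <-; rewrite ReD. Qed.

Lemma Re_ge0 (x : C) : 0 <= x -> 0 <= Re x.
Proof. by rewrite lecE => /andP[]. Qed.

(** This is the trace of [F] times the transpose of [G]: bilinear, with no conjugation. *)
Definition pairing T (F G : fop R T) : C := \sum_t \sum_t' F t t' * G t t'.

Lemma sum_unit (F : unit -> C) : \sum_u F u = F tt.
Proof. by rewrite (bigD1 tt) //= big1 ?addr0 // => -[]. Qed.

Lemma pairing_unit (F G : fop R unit) : pairing F G = F tt tt * G tt tt.
Proof. by rewrite /pairing !sum_unit. Qed.

Definition lin T (a : C) (F : fop R T) (b : C) (G : fop R T) : fop R T :=
  fun t t' => a * F t t' + b * G t t'.

(** The primal and dual constraints are written with the next four maps, which are adjoint in pairs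
    for [pairing]: [ext_out] with [tr_out], and [tr_in] with [ext_in]. *)
Definition ext_out H X Y (Q : fop R (H * X)%type) : fop R (H * (X * Y))%type :=
  fun u u' => Q (u.1, u.2.1) (u'.1, u'.2.1) * (u.2.2 == u'.2.2)%:R.

Definition tr_in H X (Q : fop R (H * X)%type) : fop R H :=
  fun h h' => \sum_x Q (h, x) (h', x).

Definition tr_out H X Y (J : fop R (H * (X * Y))%type) : fop R (H * X)%type :=
  fun u u' => \sum_y J (u.1, (u.2, y)) (u'.1, (u'.2, y)).

Definition ext_in H X (J : fop R H) : fop R (H * X)%type :=
  fun u u' => J u.1 u'.1 * (u.2 == u'.2)%:R.

(* Hermiticity is not required, so that the dual program makes sense on the real
   vector space of all operators, where the Hahn-Banach theorem is applied. *)
Definition rpos T (f : fop R T) := forall v, 0 <= Re (quad f v).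

Lemma quad_lin T a (F : fop R T) b G v :
  quad (lin a F b G) v = a * quad F v + b * quad G v.
Proof.
rewrite /quad !mulr_sumr -big_split; apply: eq_bigr => t _ /=.
rewrite !mulr_sumr -big_split; apply: eq_bigr => t' _ /=.
by rewrite /lin; ring.
Qed.

Lemma pairing_linl T a (F : fop R T) b G J :
  pairing (lin a F b G) J = a * pairing F J + b * pairing G J.
Proof.
rewrite /pairing !mulr_sumr -big_split; apply: eq_bigr => t _ /=.
rewrite !mulr_sumr -big_split; apply: eq_bigr => t' _ /=.
by rewrite /lin; ring.
Qed.

Lemma pairingC T (F G : fop R T) : pairing F G = pairing G F.
Proof. by apply: eq_bigr => t _; apply: eq_bigr => t' _; rewrite mulrC. Qed.

Lemma ext_out_lin H X Y a (F : fop R (H * X)%type) b G :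
  ext_out (Y := Y) (lin a F b G) = lin a (ext_out F) b (ext_out G).
Proof. by apply/funext => t; apply/funext => t'; rewrite /ext_out /lin; ring. Qed.

Lemma tr_in_lin H X a (F : fop R (H * X)%type) b G :
  tr_in (lin a F b G) = lin a (tr_in F) b (tr_in G).
Proof.
apply/funext => t; apply/funext => t'.
by rewrite /tr_in /lin big_split /= !mulr_sumr.
Qed.

Lemma tr_out_lin H X Y a (F : fop R (H * (X * Y))%type) b G :
  tr_out (lin a F b G) = lin a (tr_out F) b (tr_out G).
Proof.
apply/funext => t; apply/funext => t'.
by rewrite /tr_out /lin big_split /= !mulr_sumr.
Qed.

Lemma ext_in_lin H X a (F : fop R H) b G :
  ext_in (X := X) (lin a F b G) = lin a (ext_in F) b (ext_in G).
Proof. by apply/funext => t; apply/funext => t'; rewrite /ext_in /lin; ring. Qed.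

Lemma pairing_ext_out H X Y (Q : fop R (H * X)%type) (J : fop R (H * (X * Y))%type) :
  pairing (ext_out Q) J = pairing Q (tr_out J).
Proof.
rewrite /pairing /ext_out /tr_out.
transitivity (\sum_(u : H * X) \sum_(y : Y) \sum_(u' : H * X) \sum_(y' : Y)
   Q u u' * J (u.1, (u.2, y)) (u'.1, (u'.2, y')) * (y' == y)%:R).
  rewrite [RHS]pair_big /= [LHS](reindex (fun p : H * X * Y => (p.1.1, (p.1.2, p.2)))) /=.
    apply: eq_bigr => -[[h x] y] _ /=.
    rewrite [RHS]pair_big /= [LHS](reindex (fun p : H * X * Y => (p.1.1, (p.1.2, p.2)))) /=.
      by apply: eq_bigr => -[[h' x'] y'] _ /=; rewrite eq_sym; ring.
    by exists (fun p => (p.1, p.2.1, p.2.2)) => [[[? ?] ?]|[? [? ?]]].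
  by exists (fun p => (p.1, p.2.1, p.2.2)) => [[[? ?] ?]|[? [? ?]]].
apply: eq_bigr => u _; rewrite exchange_big; apply: eq_bigr => u' _ /=.
rewrite mulr_sumr; apply: eq_bigr => y _.
by rewrite sum_delta_r.
Qed.

Lemma pairing_ext_in H X (Q : fop R (H * X)%type) (J : fop R H) :
  pairing Q (ext_in J) = pairing (tr_in Q) J.
Proof.
rewrite /pairing /ext_in /tr_in.
transitivity (\sum_h \sum_x \sum_h' \sum_x' Q (h, x) (h', x') * J h h' * (x' == x)%:R).
  rewrite [RHS]pair_big /=; apply: eq_bigr => -[h x] _ /=.
  rewrite [RHS]pair_big /=; apply: eq_bigr => -[h' x'] _ /=.
  by rewrite eq_sym mulrA.
apply: eq_bigr => h _; rewrite exchange_big; apply: eq_bigr => h' _ /=.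
rewrite mulr_suml; apply: eq_bigr => x _.
by rewrite sum_delta_r.
Qed.

(** Pairing with a rank-one term of [G] evaluates the form of [F] at the conjugated vector. *)
Lemma pairing_gram T (F G : fop R T) : gram G ->
  exists (K : finType) (a : K -> T -> C), pairing F G = \sum_k quad F (a k).
Proof.
move=> [K [a GE]]; exists K, (fun k t => (a k t)^*).
rewrite exchange_big; apply: eq_bigr => t _ /=.
rewrite exchange_big; apply: eq_bigr => t' _ /=.
by rewrite GE mulr_sumr; apply: eq_bigr => k _; rewrite conjCK; ring.
Qed.

Lemma pairing_rpos T (F G : fop R T) : rpos F -> gram G -> 0 <= Re (pairing F G).
Proof.
move=> hF /(pairing_gram F)[K [a ->]]; rewrite Re_sum.
by apply: sumr_ge0 => k _; apply: hF.
Qed.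

Lemma rpos_lin T a (F : fop R T) b G : 0 <= a -> 0 <= b ->
  rpos F -> rpos G -> rpos (lin a%:C%C F b%:C%C G).
Proof.
move=> a0 b0 hF hG v; rewrite quad_lin ReD !ReZ.
by rewrite addr_ge0 // mulr_ge0.
Qed.

Lemma rpos_bound T (F : fop R T) : exists M : R,
  rpos (lin M%:C%C (fun t t' => (t == t')%:R) (-1) F).
Proof.
(* Each product [|v_t| |v_t'|] is at most [|v_t|^2 + |v_t'|^2], hence at most twice the squared norm
   of [v]. *)
pose M : C := 2 * \sum_t \sum_t' `|F t t'|.
have M0 : 0 <= M.
  by rewrite mulr_ge0 // sumr_ge0 // => t _; rewrite sumr_ge0.
exists (Re M) => v.
have -> : (Re M)%:C%C = M by rewrite RRe_real // ger0_real.
rewrite quad_lin.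
pose N : C := \sum_t `|v t| ^+ 2.
have -> : quad (fun t t' => (t == t')%:R) v = N.
  apply: eq_bigr => t _; under eq_bigr do rewrite -mulrA.
  rewrite -mulr_sumr; under eq_bigr do rewrite eq_sym.
  by rewrite sum_delta_l normCK mulrC.
have vN t : `|v t| ^+ 2 <= N.
  by rewrite /N (bigD1 t) //= lerDl sumr_ge0 // => s _; rewrite exprn_ge0.
have qN : `|quad F v| <= M * N.
  apply: le_trans (ler_norm_sum _ _ _) _.
  rewrite /M -mulrA mulr_suml mulr_sumr; apply: ler_sum => t _.
  apply: le_trans (ler_norm_sum _ _ _) _.
  rewrite mulr_suml mulr_sumr; apply: ler_sum => t' _.
  rewrite !normrM norm_conjC mulrAC mulrC [leRHS]mulrCA; apply: ler_wpM2l => //.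
  have h : `|v t| * `|v t'| <= `|v t| ^+ 2 + `|v t'| ^+ 2.
    have [le1|le1] := real_leP (normr_real (v t)) (normr_real (v t')).
      apply: (@le_trans _ _ (`|v t'| ^+ 2)); last by rewrite lerDr exprn_ge0.
      by rewrite expr2 ler_wpM2r.
    apply: (@le_trans _ _ (`|v t| ^+ 2)); last by rewrite lerDl exprn_ge0.
    by rewrite expr2 ler_wpM2l // ltW.
  by apply: (le_trans h); rewrite mulr_natl mulr2n lerD.
have h : (Re (quad F v))%:C%C <= M * N.
  apply: le_trans qN; apply: le_trans (normc_ge_Re _).
  by rewrite lecR ler_norm.
move: h; rewrite lecE /= => /andP[_ h].
by rewrite ReD mulN1r raddfN /= subr_ge0.
Qed.

End Pairing.

(** * Duality *)

Section Duality.
Variables (R : realType) (X Y : nat -> finType).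
Local Notation C := R[i].
Local Notation Re := complex.Re.
Local Notation Im := complex.Im.

Fixpoint hist (m : nat) : finType :=
  match m with
  | 0 => unit
  | i.+1 => (hist i * (X i * Y i))%type
  end.

(* [dual_le F c]: the semidefinite program maximizing [Re (pairing F J)] over the
   operators [J] of Bob's strategies with [m] rounds has a dual feasible
   solution of value at most [c]. *)
Fixpoint dual_le m : fop R (hist m) -> R -> Prop :=
  match m return fop R (hist m) -> R -> Prop with
  | 0 => fun F c => Re (F tt tt) <= c
  | i.+1 => fun F c => exists Q : fop R (hist i * X i)%type,
      rpos (lin 1 (ext_out Q) (-1) F) /\ dual_le (tr_in Q) c
  end.

(** These are the Choi operators of quantum strategies, also called quantum combs; the last clause
    is causality. *)
Definition strat m (J : forall i, fop R (hist i)) :=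
  [/\ J 0%N tt tt = 1, forall i, (i <= m)%N -> gram (J i)
    & forall i, (i < m)%N -> tr_out (J i.+1) = ext_in (J i)].

(** Positivity of the slack replaces [F] by [ext_out Q]; adjointness and causality then move the
    pairing down to [tr_in Q] against [J m]. *)
Lemma weak_duality m J (F : fop R (hist m)) c :
  strat m J -> dual_le F c -> Re (pairing F (J m)) <= c.
Proof.
move=> [J0 Jg Jt]; elim: m F Jg Jt => [|m IH] F Jg Jt /=.
  by rewrite pairing_unit J0 mulr1.
move=> [Q [hQ /IH h]]; have := pairing_rpos hQ (Jg m.+1 (leqnn _)).
rewrite pairing_linl pairing_ext_out Jt // pairing_ext_in ReD mul1r mulN1r raddfN /= subr_ge0.
move=> /le_trans; apply; apply: h => [i im|i im]; first by apply: Jg; apply: leqW.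
by apply: Jt; apply: leqW.
Qed.

Lemma dual_lin m (F G : fop R (hist m)) a b c d : 0 <= a -> 0 <= b ->
  dual_le F c -> dual_le G d -> dual_le (lin a%:C%C F b%:C%C G) (a * c + b * d).
Proof.
move=> a0 b0; elim: m F G => [|m IH] F G /=.
  by move=> h1 h2; rewrite /lin ReD !ReZ lerD // ler_wpM2l.
move=> [Q [hQ dQ]] [P [hP dP]]; exists (lin a%:C%C Q b%:C%C P).
rewrite tr_in_lin; split; last exact: IH.
rewrite ext_out_lin.
set f := (X in rpos X).
have -> : f = lin a%:C%C (lin 1 (ext_out Q) (-1) F) b%:C%C (lin 1 (ext_out P) (-1) G).
  by apply/funext => t; apply/funext => t'; rewrite /f /lin; ring.
exact: rpos_lin.
Qed.

Lemma dual_mono m (F : fop R (hist m)) c d : c <= d -> dual_le F c -> dual_le F d.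
Proof.
move=> cd; elim: m F => [|m IH] F /=; first by move=> /le_trans; apply.
by move=> [Q [hQ dQ]]; exists Q; split=> //; apply: IH.
Qed.

Lemma dual_exists m (F : fop R (hist m)) : exists c, dual_le F c.
Proof.
elim: m F => [|m IH] F /=; first by exists (Re (F tt tt)).
have [M hM] := rpos_bound F.
pose Q : fop R (hist m * X m)%type := fun u u' => M%:C%C * (u == u')%:R.
have [c hc] := IH (tr_in Q); exists c, Q; split=> //.
suff <- : lin M%:C%C (fun t t' => (t == t')%:R) (-1) F = lin 1 (ext_out Q) (-1) F by [].
apply/funext => -[h [x y]]; apply/funext => -[h' [x' y']].
rewrite /lin /ext_out /Q /= !xpair_eqE mul1r -mulrA -natrM mulnb -andbA.
by [].
Qed.

Lemma tr_in0 (S T : finType) :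
  tr_in (X := T) (fun _ _ => 0) = (fun _ _ => 0 : C) :> fop R S.
Proof. by apply/funext => h; apply/funext => h'; rewrite /tr_in big1. Qed.

Lemma ext_out0 (H S T : finType) :
  ext_out (fun _ _ => 0) = (fun _ _ => 0 : C) :> fop R (H * (S * T))%type.
Proof. by apply/funext => h; apply/funext => h'; rewrite /ext_out mul0r. Qed.

Lemma quad0 (T : finType) (v : T -> C) : quad (fun _ _ => 0) v = 0.
Proof.
by rewrite /quad big1 // => t _; rewrite big1 // => t' _; rewrite mulr0 mul0r.
Qed.

Lemma dual0 m : dual_le (m := m) (fun _ _ => 0) 0.
Proof.
elim: m => [|m IH] /=; first exact: lexx.
exists (fun _ _ => 0); split; last by rewrite tr_in0.
by move=> v; rewrite quad_lin ext_out0 quad0 !mulr0 addr0.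
Qed.

Lemma dual_ext_out m (Q : fop R (hist m * X m)%type) c :
  dual_le (tr_in Q) c -> dual_le (m := m.+1) (ext_out Q) c.
Proof.
move=> h; exists Q; split=> // v.
by rewrite quad_lin mul1r mulN1r subrr.
Qed.

Lemma dual_rneg m (F : fop R (hist m.+1)) :
  rpos (fun t t' => - F t t') -> dual_le F 0.
Proof.
move=> hF; exists (fun _ _ => 0); split.
  suff -> : lin 1 (ext_out (fun _ _ => 0)) (-1) F = (fun t t' => - F t t') by [].
  by apply/funext => t; apply/funext => t'; rewrite /lin /ext_out mul0r; ring.
by rewrite tr_in0; apply: dual0.
Qed.

Lemma pairing_delta (T : finType) (G : fop R T) c t t' :
  pairing (fun s s' => c * ((s == t)%:R * (s' == t')%:R)) G = c * G t t'.
Proof.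
transitivity (\sum_s (s == t)%:R * (c * G s t')).
  apply: eq_bigr => s _.
  transitivity (\sum_s' (s' == t')%:R * (c * ((s == t)%:R * G s s'))).
    by apply: eq_bigr => s' _; ring.
  by rewrite sum_delta_l; ring.
by rewrite sum_delta_l.
Qed.

Lemma Re_mul_inj (x y : C) : (forall c, Re (c * x) = Re (c * y)) -> x = y.
Proof.
move=> h; have := h 1; have := h (Complex 0 1); rewrite !mul1r.
by case: x {h} => a b; case: y => c d /= + ->; rewrite !mul0r !mul1r !sub0r => /oppr_inj ->.
Qed.

Lemma pairing_inj (T : finType) (F G : fop R T) :
  (forall Q, Re (pairing Q F) = Re (pairing Q G)) -> F = G.
Proof.
move=> h; apply/funext => t; apply/funext => t'; apply: Re_mul_inj => c.
by rewrite -!pairing_delta.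
Qed.

Lemma pairing_rank1 (T : finType) (F : fop R T) v :
  pairing (fun t t' => (v t)^* * v t') F = quad F v.
Proof. by apply: eq_bigr => t _; apply: eq_bigr => t' _; ring. Qed.

Lemma quad_rank1_ge0 (T : finType) (v w : T -> C) :
  0 <= quad (fun t t' => (v t)^* * v t') w.
Proof.
apply: gram_pos; exists unit, (fun _ t => (v t)^*) => t t'.
by rewrite sum_unit conjCK.
Qed.

(** Each primal constraint is read off from operators of known dual value: scalars give the
    normalization, negative operators give positivity, and [ext_out Q] with [tr_in Q = 0] gives
    causality. The operator for fewer rounds is a block of [tr_out J0]. *)
Lemma functional_strat m (J0 : fop R (hist m)) :
  (forall i, (i < m)%N -> inhabited (X i)) ->
  (forall F c, dual_le F c -> Re (pairing F J0) <= c) ->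
  exists2 J, strat m J & J m = J0.
Proof.
elim: m J0 => [|m IH] J0 hX hJ.
  have h c : Re (c * J0 tt tt) <= Re c.
    have := hJ (fun _ _ => c) (Re c) (lexx _).
    by rewrite pairing_unit.
  have J1 : J0 tt tt = 1.
    apply: Re_mul_inj => c; rewrite mulr1; apply/le_anti; rewrite h /=.
    by have := h (- c); rewrite mulNr !raddfN /= lerN2.
  pose J := dfwith (fun i : nat => (fun _ _ => 0) : fop R (hist i)) (i := 0%N) J0.
  exists J; last by rewrite /J dfwith_in.
  split=> [|i|//]; first by rewrite /J dfwith_in.
  rewrite leqn0 => /eqP ->; rewrite /J dfwith_in.
  exists unit, (fun _ _ => 1) => -[] [].
  by rewrite sum_unit conjC1 mulr1.
have [x0] := hX m (ltnSn m).
(* Causality will make all diagonal question blocks equal, so the one at [x0] serves. [inj] is a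
   right inverse of [tr_in] and is adjoint to taking this block. *)
pose J' : fop R (hist m) := fun h h' => tr_out J0 (h, x0) (h', x0).
pose inj (F : fop R (hist m)) : fop R (hist m * X m)%type :=
  fun u u' => F u.1 u'.1 * ((u.2 == x0)%:R * (u'.2 == x0)%:R).
have tr_inj F : tr_in (inj F) = F.
  apply/funext => h; apply/funext => h'; rewrite /tr_in /inj /=.
  under eq_bigr => x _ do rewrite mulrA mulrAC.
  by rewrite sum_delta_r eqxx mulr1.
have pairing_inj' F : pairing (inj F) (tr_out J0) = pairing F J'.
  rewrite /pairing /J' -(pair_bigA _ (fun h x =>
    \sum_u' inj F (h, x) u' * tr_out J0 (h, x) u')) /=.
  apply: eq_bigr => h _.
  transitivity (\sum_x (x == x0)%:R * \sum_h' F h h' * tr_out J0 (h, x) (h', x0)).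
    apply: eq_bigr => x _.
    rewrite -(pair_bigA _ (fun h' x' =>
      inj F (h, x) (h', x') * tr_out J0 (h, x) (h', x'))) /=.
    rewrite mulr_sumr; apply: eq_bigr => h' _.
    transitivity (\sum_x' (x' == x0)%:R * ((x == x0)%:R *
        (F h h' * tr_out J0 (h, x) (h', x')))).
      by apply: eq_bigr => x' _; rewrite /inj /=; ring.
    by rewrite sum_delta_l.
  by rewrite sum_delta_l.
have hQ Q : tr_in Q = (fun _ _ => 0) -> Re (pairing Q (tr_out J0)) <= 0.
  move=> trQ; rewrite -pairing_ext_out; apply: hJ; apply: dual_ext_out.
  by rewrite trQ; apply: dual0.
have tr_out0 : tr_out J0 = ext_in J'.
  apply: pairing_inj => Q; rewrite pairing_ext_in -pairing_inj'.
  (* For [a = 1] the operator has zero partial trace, for [a = -1] it is its analogue with the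
     opposite sign on [inj]'s argument. *)
  have key a : Re (pairing (lin a Q (- a) (inj (tr_in Q))) (tr_out J0)) <= 0.
    apply: hQ; rewrite tr_in_lin tr_inj.
    by apply/funext => h; apply/funext => h'; rewrite /lin; ring.
  have := key (-1); have := key 1.
  rewrite !pairing_linl !ReD opprK !mulN1r !mul1r !raddfN /=; lra.
have [F c dF|J [J1 Jg Jt] Jm] := IH J' (fun i im => hX i (leqW im)).
  by rewrite -pairing_inj' -pairing_ext_out;
    apply: hJ; apply: dual_ext_out; rewrite tr_inj.
have gJ0 : gram J0.
  apply: pos_gram => v; rewrite -pairing_rank1.
  set V := fun t t' => (v t)^* * v t'.
  (* Since [rpos] sees only real parts, [a V] has dual value at most 0 for [a = -1, i, -i]. These
     three cases force the pairing to be real and nonnegative. *)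
  have h a : (forall z : C, 0 <= z -> Re (a * z) <= 0) -> Re (a * pairing V J0) <= 0.
    move=> ha; have -> : a * pairing V J0 = pairing (lin a V 0 V) J0.
      by rewrite pairing_linl mul0r addr0.
    apply: hJ; apply: dual_rneg => w.
    have -> : (fun t t' => - lin a V 0 V t t') = lin (- a) V 0 V.
      by apply/funext => t; apply/funext => t'; rewrite /lin; ring.
    rewrite quad_lin mul0r addr0 mulNr raddfN /= oppr_ge0.
    exact/ha/quad_rank1_ge0.
  have h1 : Re (- 1 * pairing V J0) <= 0.
    by apply: h => z /Re_ge0; rewrite mulN1r raddfN /= oppr_le0.
  have h2 : Re (Complex 0 1 * pairing V J0) <= 0.
    by apply: h => -[a b] /ger0_Im /= ->; rewrite mul0r mulr0 subr0.
  have h3 : Re (Complex 0 (-1) * pairing V J0) <= 0.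
    by apply: h => -[a b] /ger0_Im /= ->; rewrite mul0r mulr0 subr0.
  move: h1 h2 h3; case: (pairing V J0) => a b /= h1 h2 h3.
  by rewrite lecE /=; apply/andP; split; [apply/eqP|]; lra.
pose K := dfwith J (i := m.+1) J0.
have Kout i : (i <= m)%N -> K i = J i.
  by move=> im; rewrite /K dfwith_out // gtn_eqF // ltnS.
exists K; last by rewrite /K dfwith_in.
split=> [|i|i].
- by rewrite Kout.
- rewrite leq_eqVlt => /orP[/eqP ->|im]; first by rewrite /K dfwith_in.
  by rewrite Kout //; apply: Jg.
- rewrite ltnS leq_eqVlt => /orP[/eqP ->|im].
    by rewrite (Kout m) // /K dfwith_in Jm.
  by rewrite !Kout ?Jt // ltnW.
Qed.
(** Bob answers every question with the maximally mixed state. This strategy bounds dual values from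
    below and supplies a positive definite point for mixing. *)
Definition uniform i : fop R (hist i) :=
  fun h h' => (h == h')%:R * (\prod_(j < i) #|Y j|%:R)^-1.

Lemma uniform_strat m : (forall i, (i < m)%N -> inhabited (Y i)) ->
  strat m uniform.
Proof.
move=> hY; split=> [|i im|i im].
- by rewrite /uniform eqxx big_ord0 invr1 mulr1.
- pose s : C := sqrtC (\prod_(j < i) #|Y j|%:R)^-1.
  have s0 : 0 <= s by rewrite sqrtC_ge0 invr_ge0 prodr_ge0.
  exists (hist i), (fun k h => (h == k)%:R * s) => h h'.
  under eq_bigr => k _ do rewrite rmorphM /= conjC_nat [h == k]eq_sym -!mulrA.
  rewrite sum_delta_l (CrealP (ger0_real s0)) mulrCA -expr2 sqrtCK /uniform.
  by rewrite eq_sym mulrC mulrC.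
- apply/funext => -[h x]; apply/funext => -[h' x'].
  rewrite /tr_out /ext_in /uniform /=.
  under eq_bigr => y _ do rewrite !xpair_eqE eqxx andbT.
  rewrite sumr_const big_ord_recr /= invfM -mulnb natrM -[LHS]mulr_natr.
  have [y] := hY i im.
  have Y0 : #|Y i|%:R != 0 :> C.
    by rewrite pnatr_eq0 -lt0n; apply/card_gt0P; exists y.
  have P0 : \prod_(j < i) #|Y j|%:R != 0 :> C.
    apply/prodf_neq0 => j _; rewrite pnatr_eq0 -lt0n.
    by have [z] := hY j (ltn_trans (ltn_ord j) im); apply/card_gt0P; exists z.
  by field; rewrite Y0 P0.
Qed.

(** Real coordinates, real and imaginary parts, on which the real Hahn-Banach theorem acts. *)
Let opof (T : finType) (g : {ffun T * T * bool -> R^o}) : fop R T :=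
  fun t t' => Complex (g (t, t', false)) (g (t, t', true)).

(** The optimal dual value is a sublinear function of the payoff. A linear functional supporting it
    at [F] is a strategy by [functional_strat], and that strategy attains the dual value. *)
Lemma strong_duality m (F : fop R (hist m)) v :
  (forall i, (i < m)%N -> inhabited (X i)) ->
  (forall i, (i < m)%N -> inhabited (Y i)) ->
  (forall J, strat m J -> Re (pairing F (J m)) <= v) ->
  forall e, 0 < e -> dual_le F (v + e).
Proof.
move=> hX hY hv e e0.
pose vals (g : {ffun hist m * hist m * bool -> R^o}) : set R :=
  [set c | dual_le (opof g) c]%classic.
have hinf g : has_inf (vals g).
  split; first exact: dual_exists.
  (* Weak duality against the uniform strategy keeps the infimum finite. *)
  by exists (Re (pairing (opof g) (@uniform m))) => c; apply/weak_duality/uniform_strat.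
pose p g := inf (vals g).
have ple g c : dual_le (opof g) c -> p g <= c.
  by move=> h; apply: ge_inf => //; case: (hinf g).
have pge g c : (forall d, dual_le (opof g) d -> c <= d) -> c <= p g.
  by move=> h; apply: lb_le_inf => //; case: (hinf g).
have hp : sublinear p.
  split=> [g g'|c g c0].
    rewrite -lerBlDr; apply: (pge) => d hd.
    rewrite lerBlDr -lerBlDl; apply: (pge) => d' hd'.
    rewrite lerBlDl; apply: (ple).
    have -> : opof (g + g') = lin 1%:C%C (opof g) 1%:C%C (opof g').
      apply/funext => t; apply/funext => t'; rewrite /opof /lin !ffunE !mul1r.
      by [].
    by rewrite -[d]mul1r -[d']mul1r; apply: dual_lin.
  have hZ : opof (c *: g) = lin c%:C%C (opof g) 0%:C%C (opof g).
    apply/funext => t; apply/funext => t'; rewrite /opof /lin !ffunE mul0r addr0.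
    by rewrite /GRing.scale /GRing.mul /= !mul0r subr0 addr0.
  have hd d : dual_le (opof g) d -> dual_le (opof (c *: g)) (c * d).
    by move=> h; rewrite hZ (_ : c * d = c * d + 0 * d); [apply: dual_lin|ring].
  have [c00|c1] := eqVneq c 0.
    have [d /hd] := dual_exists (opof g).
    by rewrite c00 !mul0r => /ple.
  have cp : 0 < c by rewrite lt0r c1.
  by rewrite -ler_pdivrMl //; apply: (pge) => d /hd /ple; rewrite ler_pdivrMl.
pose g0 : {ffun hist m * hist m * bool -> R^o} :=
  [ffun i => if i.2 then Im (F i.1.1 i.1.2) else Re (F i.1.1 i.1.2)].
have opg0 : opof g0 = F.
  by apply/funext => t; apply/funext => t'; rewrite /opof !ffunE /=; case: (F t t').
have [l [lp pl]] := sublinear_support g0 hp.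
(* The minus sign makes the real part of the complex pairing equal to the real one. *)
pose J0 : fop R (hist m) := fun t t' => Complex (l (t, t', false)) (- l (t, t', true)).
have pairingE g : Re (pairing (opof g) J0) = \sum_i g i * l i.
  transitivity (\sum_t \sum_t' \sum_b g (t, t', b) * l (t, t', b)).
    rewrite /pairing Re_sum; apply: eq_bigr => t _.
    rewrite Re_sum; apply: eq_bigr => t' _.
    by rewrite big_bool /= mulrN opprK addrC.
  by rewrite !pair_bigA /=; apply: eq_bigr => -[[? ?] ?] _.
have [G c dG|J sJ Jm] := functional_strat (J0 := J0) hX.
  pose g : {ffun hist m * hist m * bool -> R^o} :=
    [ffun i => if i.2 then Im (G i.1.1 i.1.2) else Re (G i.1.1 i.1.2)].
  have opg : opof g = G.
    by apply/funext => t; apply/funext => t'; rewrite /opof !ffunE /=; case: (G t t').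
  by rewrite -opg pairingE; apply: le_trans (lp g) _; apply: (ple); rewrite opg.
have pv : p g0 <= v.
  by apply: le_trans pl _; rewrite -pairingE opg0 -Jm; apply: hv.
have [c hc cv] := inf_adherent e0 (hinf g0).
rewrite -opg0; apply: dual_mono hc; apply: ltW; apply: lt_le_trans cv _.
by rewrite lerD2r.
Qed.

End Duality.

(** * Transcripts of an interaction *)

Section Superoperators.
Variable R : realType.
Local Notation C := R[i].
Implicit Types S T W M : finType.

Lemma superop_sum S T (K : finType) (F : superop R S T) (c : K -> C)
    (f : K -> fop R S) : linear F ->
  F (mkop (fun s s' => \sum_k c k * f k s s')) =
  mkop (fun t t' => \sum_k c k * entry (F (mkop (f k))) t t').
Proof.
move=> hF.
have F0 : F 0 = 0.
  by have := hF (-1) 0 0; rewrite scaler0 addr0 scaleN1r addNr.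
have hsum : F (\sum_k c k *: mkop (f k)) = \sum_k c k *: F (mkop (f k)).
  elim/big_rec2: _ => [//|k x y _ <-]; exact: hF.
transitivity (F (\sum_k c k *: mkop (f k))).
  congr F; apply/matrixP => i j; rewrite mxE summxE.
  by apply: eq_bigr => k _; rewrite !mxE.
rewrite hsum; apply/matrixP => i j; rewrite mxE summxE.
by apply: eq_bigr => k _; rewrite /entry !enum_valK mxE.
Qed.

Lemma gram_eq T (f g : fop R T) : (forall t t', f t t' = g t t') -> gram f -> gram g.
Proof. by move=> fg [K [a h]]; exists K, a => t t'; rewrite -fg. Qed.

Lemma gram_pull S T (f : fop R T) (c : S -> C) (phi : S -> T) : gram f ->
  gram (fun s s' => c s * (c s')^* * f (phi s) (phi s')).
Proof.
move=> [K [a fE]]; exists K, (fun k s => c s * a k (phi s)) => s s'.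
rewrite fE mulr_sumr; apply: eq_bigr => k _.
by rewrite rmorphM /= mulrACA.
Qed.

Lemma gram_comp S T (f : fop R T) (phi : S -> T) :
  gram f -> gram (fun s s' => f (phi s) (phi s')).
Proof.
move=> /(gram_pull (fun=> 1) phi); apply: gram_eq => t t'.
by rewrite conjC1 !mul1r.
Qed.

Lemma gram_tr W M (f : fop R (W * M)%type) :
  gram f -> gram (fun w w' => \sum_m f (w, m) (w', m)).
Proof.
move=> [K [a fE]]; exists (K * M)%type, (fun k w => a k.1 (w, k.2)) => w w'.
by under eq_bigr do rewrite fE; rewrite exchange_big pair_bigA.
Qed.

(** A jointly positive family indexed by [W] is a block operator with [W] as ancilla, which is what
    complete positivity handles. *)
Lemma cp_gram S T W (F : superop R S T) (fam : W -> W -> Op R S) :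
  completely_positive F ->
  gram (fun u u' : W * S => entry (fam u.1 u'.1) u.2 u'.2) ->
  gram (fun u u' : W * T => entry (F (fam u.1 u'.1)) u.2 u'.2).
Proof.
move=> hF hfam.
pose A : Op R (S * W) := mkop (fun u u' => entry (fam u.2 u'.2) u.1 u'.1).
have /hF : psd A.
  by apply/psd_mkop/gram_pos; apply: (gram_comp (fun u => (u.2, u.1)) hfam).
move=> /psd_mkop /pos_gram /(gram_comp (fun u : W * T => (u.2, u.1))).
apply: gram_eq => -[w t] [w' t'] /=; congr (entry (F _) _ _).
rewrite /A entry_mkop /= -[RHS]mkop_entry.
by [].
Qed.

Lemma sum_prod (S T : finType) (F : S * T -> C) :
  \sum_u F u = \sum_s \sum_t F (s, t).
Proof. by rewrite pair_bigA; apply: eq_bigr => -[]. Qed.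

Lemma sum_hist (H X Y : finType) (F : H * (X * Y) -> C) :
  \sum_u F u = \sum_h \sum_x \sum_y F (h, (x, y)).
Proof. by rewrite sum_prod; apply: eq_bigr => h _; rewrite sum_prod. Qed.

End Superoperators.

(** * Factorization of a run into Alice's and Bob's operators *)

Section Transcript.
Variables (R : realType) (O : finType) (G : interaction R O).
Local Notation C := R[i].
Local Notation Re := complex.Re.
Local Notation X := (amsg G).
Local Notation Y := (bmsg G).
Local Notation Z := (amem G).
Local Notation hist := (hist X Y).

(* Alice's unnormalized state given the message histories [h] and [h'] on the
   ket and bra sides. *)
Fixpoint alice_op i : hist i -> hist i -> Op R (X i * Z i) :=
  match i return hist i -> hist i -> Op R (X i * Z i) with
  | 0 => fun _ _ => first_msg G
  | j.+1 => fun h h' => resp G j (mkop (fun u u' =>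
      (u.1 == h.2.2)%:R * (u'.1 == h'.2.2)%:R *
      entry (alice_op h.1 h'.1) (h.2.1, u.2) (h'.2.1, u'.2)))
  end.

(** The measurement takes its bra and ket indices exchanged because a probability is the trace of a
    product, while [pairing] does not transpose. *)
Definition outcome_op (o : O) : fop R (hist (last_round G).+1) := fun u u' =>
  \sum_z \sum_z' entry (meas G o) (u'.2.2, z') (u.2.2, z) *
    entry (alice_op u.1 u'.1) (u.2.1, z) (u'.2.1, z').


(** Fixing Bob's answer compresses the family and keeps it Gram; Alice's channel then acts with the
    history as ancilla. *)
Lemma gram_alice_op i : valid_interaction G -> (i <= last_round G)%N ->
  gram (fun u u' : hist i * (X i * Z i) => entry (alice_op u.1 u'.1) u.2 u'.2).
Proof.
move=> [[hrho _] hresp _]; elim: i => [|i IH] hi.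
  by apply: (gram_comp (f := entry (first_msg G)) snd); apply: pos_gram; apply/psdE.
have [_ hcp _] := hresp i hi.
have := IH (ltnW hi).
move=> /(gram_pull (fun w : hist i.+1 * (Y i * Z i) => (w.2.1 == w.1.2.2)%:R)
  (fun w => (w.1.1, (w.1.2.1, w.2.2)))) h.
pose fam (w w' : hist i.+1) : Op R (Y i * Z i) := mkop (fun u u' =>
  (u.1 == w.2.2)%:R * (u'.1 == w'.2.2)%:R *
  entry (alice_op w.1 w'.1) (w.2.1, u.2) (w'.2.1, u'.2)).
apply: (cp_gram (fam := fam) hcp); apply: gram_eq h => u u'.
by rewrite /fam entry_mkop conjC_nat.
Qed.

Lemma gram_outcome_op o : valid_interaction G -> gram (outcome_op o).
Proof.
move=> hG; have [_ _ [hmeas _]] := hG.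
have [K [a aE]] := gram_alice_op hG (leqnn _).
have [L [b bE]] : gram (entry (meas G o)) by apply: pos_gram; apply/psdE.
exists (K * L)%type,
  (fun k u => \sum_z (b k.2 (u.2.2, z))^* * a k.1 (u.1, (u.2.1, z))) => u u'.
rewrite [RHS]sum_prod /=.
transitivity (\sum_k \sum_l \sum_z \sum_z' (b l (u.2.2, z))^* * a k (u.1, (u.2.1, z)) *
    (b l (u'.2.2, z') * (a k (u'.1, (u'.2.1, z')))^*)); last first.
  apply: eq_bigr => k _; apply: eq_bigr => l _.
  rewrite rmorph_sum big_distrlr /=; apply: eq_bigr => z _; apply: eq_bigr => z' _.
  by rewrite rmorphM /= conjCK.
under [RHS]eq_bigr => k _ do rewrite exchange_big.
rewrite [RHS]exchange_big; apply: eq_bigr => z _ /=.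
under [RHS]eq_bigr => k _ do rewrite exchange_big.
rewrite [RHS]exchange_big; apply: eq_bigr => z' _ /=.
rewrite bE (aE (u.1, (u.2.1, z)) (u'.1, (u'.2.1, z'))) mulrC big_distrlr /=.
by apply: eq_bigr => k _; apply: eq_bigr => l _; ring.
Qed.

Variable B : strategy G.

(** Counterpart of [alice_op] for Bob's memory: the question [|x><x'|] is fed in and the answer
    block between [y] and [y'] is read off. *)
Fixpoint bob_op i : hist i -> hist i -> Op R (bmem B i) :=
  match i return hist i -> hist i -> Op R (bmem B i) with
  | 0 => fun _ _ => bob_init B
  | j.+1 => fun h h' => mkop (fun m m' => entry (bob_act B j (mkop (fun u u' =>
      (u.1 == h.2.1)%:R * (u'.1 == h'.2.1)%:R *
      entry (bob_op h.1 h'.1) u.2 u'.2))) (h.2.2, m) (h'.2.2, m'))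
  end.

Definition bob_strat i : fop R (hist i) := fun h h' => \tr (bob_op h h').

Lemma gram_bob_op i : (i <= (last_round G).+1)%N ->
  gram (fun u u' : hist i * bmem B i => entry (bob_op u.1 u'.1) u.2 u'.2).
Proof.
elim: i => [|i IH] hi.
  have [h _] := bob_init_density B.
  by apply: (gram_comp (f := entry (bob_init B)) snd); apply: pos_gram; apply/psdE.
have [_ hcp _] := bob_act_channel B hi.
have := IH (ltnW hi).
move=> /(gram_pull (fun w : hist i.+1 * (X i * bmem B i) => (w.2.1 == w.1.2.1)%:R)
  (fun w => (w.1.1, w.2.2))) h.
pose fam (w w' : hist i.+1) : Op R (X i * bmem B i) := mkop (fun u u' =>
  (u.1 == w.2.1)%:R * (u'.1 == w'.2.1)%:R * entry (bob_op w.1 w'.1) u.2 u'.2).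
have /(cp_gram hcp) : gram (fun u u' : hist i.+1 * (X i * bmem B i) =>
    entry (fam u.1 u'.1) u.2 u'.2).
  by apply: gram_eq h => u u'; rewrite /fam entry_mkop conjC_nat.
move=> /(gram_comp (fun w : hist i.+1 * bmem B i.+1 => (w.1, (w.1.2.2, w.2)))).
by apply: gram_eq => u u' /=; rewrite entry_mkop.
Qed.

(** Causality is trace preservation: summing over equal answers gives the trace of the input, which
    vanishes unless the questions on both sides agree. *)
Lemma bob_strat_strat : strat (last_round G).+1 bob_strat.
Proof.
split=> [|i hi|i hi].
- by have [_ h] := bob_init_density B.
- apply: gram_eq (gram_tr (gram_bob_op hi)) => h h' /=.
  by rewrite /bob_strat tr_entry.
- have [_ _ htr] := bob_act_channel B hi.
  apply/funext => -[h x]; apply/funext => -[h' x'].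
  rewrite /tr_out /ext_in /bob_strat /=.
  transitivity (\sum_y \sum_m entry (bob_act B i (mkop (fun u u' =>
      (u.1 == x)%:R * (u'.1 == x')%:R * entry (bob_op h h') u.2 u'.2))) (y, m) (y, m)).
    by apply: eq_bigr => y _; rewrite tr_entry; apply: eq_bigr => m _; rewrite entry_mkop.
  rewrite pair_bigA /=.
  transitivity (\tr (bob_act B i (mkop (fun u u' =>
      (u.1 == x)%:R * (u'.1 == x')%:R * entry (bob_op h h') u.2 u'.2)))).
    by rewrite tr_entry; apply: eq_bigr => -[].
  rewrite htr !tr_entry mulr_suml.
  transitivity (\sum_x1 \sum_m (x1 == x)%:R * ((x1 == x')%:R * entry (bob_op h h') m m)).
    rewrite pair_bigA; apply: eq_bigr => -[x1 m] _ /=.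
    by rewrite entry_mkop mulrA.
  rewrite exchange_big; apply: eq_bigr => m _ /=.
  by rewrite sum_delta_l mulrC.
Qed.

Lemma step_entry i y z m y' z' m' (A : Op R (X i * Z i * bmem B i)) :
  entry (bob_step A) ((y, z), m) ((y', z'), m') =
  entry (bob_act B i (mkop (fun u u' => entry A ((u.1, z), u.2) ((u'.1, z'), u'.2))))
    (y, m) (y', m').
Proof.
rewrite /bob_step /swap23 entry_mkop /superop_ext entry_mkop /=.
by rewrite entry_mkop.
Qed.

(** Each channel acts on one party only, so by linearity the joint state remains a sum, over ket and
    bra histories, of an Alice factor times a Bob factor. *)
Definition decomposes i := forall x z m x' z' m',
  entry (joint_state B i) ((x, z), m) ((x', z'), m') =
  \sum_h \sum_h' entry (alice_op h h') (x, z) (x', z') * entry (bob_op h h') m m'.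

Lemma decomposes_step i : (i <= last_round G)%N -> decomposes i ->
  forall y z m y' z' m',
  entry (bob_step (joint_state B i)) ((y, z), m) ((y', z'), m') =
  \sum_(k : hist i * X i) \sum_(k' : hist i * X i)
    entry (alice_op k.1 k'.1) (k.2, z) (k'.2, z') *
    entry (bob_op (i := i.+1) (k.1, (k.2, y)) (k'.1, (k'.2, y'))) m m'.
Proof.
move=> hi IH y z m y' z' m'; rewrite step_entry.
have [hlin _ _] := bob_act_channel B hi.
(* Expand Bob's input in the units [|x><x'|], with Alice's entries as scalar coefficients. *)
pose c (k : (hist i * X i) * (hist i * X i)) :=
  entry (alice_op k.1.1 k.2.1) (k.1.2, z) (k.2.2, z').
pose f (k : (hist i * X i) * (hist i * X i)) (u u' : X i * bmem B i) : C :=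
  (u.1 == k.1.2)%:R * (u'.1 == k.2.2)%:R * entry (bob_op k.1.1 k.2.1) u.2 u'.2.
rewrite (_ : (fun u u' => _) = (fun s s' => \sum_k c k * f k s s')); last first.
  apply/funext => -[x n]; apply/funext => -[x' n'] /=; rewrite IH.
  rewrite [RHS]sum_prod [RHS]sum_prod.
  apply: eq_bigr => h _.
  transitivity (\sum_x0 (x0 == x)%:R *
      \sum_h' entry (alice_op h h') (x0, z) (x', z') *
        entry (bob_op h h') n n').
    by rewrite sum_delta_l.
  apply: eq_bigr => x0 _.
  rewrite [RHS]sum_prod mulr_sumr; apply: eq_bigr => h' _.
  transitivity (\sum_x0' (x0' == x')%:R *
      ((x0 == x)%:R * (entry (alice_op h h') (x0, z) (x0', z') *
        entry (bob_op h h') n n'))).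
    by rewrite sum_delta_l.
  by apply: eq_bigr => x0' _; rewrite /c /f /= [x == _]eq_sym [x' == _]eq_sym; ring.
rewrite superop_sum // entry_mkop [RHS]pair_bigA; apply: eq_bigr => k _.
by rewrite /c /= entry_mkop.
Qed.

Hypothesis resp_linear : forall i, (i < last_round G)%N -> linear (resp G i).

Lemma joint_state_decomposes i : (i <= last_round G)%N -> decomposes i.
Proof.
elim: i => [|i IH] hi x z m x' z' m'.
  by rewrite !sum_unit /tensop /= entry_mkop.
have hlin := resp_linear hi.
have step := decomposes_step (ltnW hi) (IH (ltnW hi)).
rewrite /= /superop_ext entry_mkop /=.
pose c (k : hist i.+1 * hist i.+1) := entry (bob_op k.1 k.2) m m'.
pose f (k : hist i.+1 * hist i.+1) (u u' : Y i * Z i) : C :=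
  (u.1 == k.1.2.2)%:R * (u'.1 == k.2.2.2)%:R *
  entry (alice_op k.1.1 k.2.1) (k.1.2.1, u.2) (k.2.2.1, u'.2).
rewrite (_ : (fun s s' => _) = (fun s s' => \sum_k c k * f k s s')); last first.
  apply/funext => -[y n]; apply/funext => -[y' n'] /=; rewrite step.
  rewrite [RHS]sum_prod [RHS]sum_hist [LHS]sum_prod.
  apply: eq_bigr => h _; apply: eq_bigr => x0 _.
  transitivity (\sum_y0 (y0 == y)%:R * \sum_k' entry (alice_op h k'.1) (x0, n) (k'.2, n') *
     entry (bob_op (i := i.+1) (h, (x0, y0)) (k'.1, (k'.2, y'))) m m').
    by rewrite sum_delta_l.
  apply: eq_bigr => y0 _; rewrite [RHS]sum_hist mulr_sumr [LHS]sum_prod.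
  apply: eq_bigr => h' _; apply: eq_bigr => x0' _.
  transitivity (\sum_y0' (y0' == y')%:R * ((y0 == y)%:R * (entry (alice_op h h') (x0, n) (x0', n') *
     entry (bob_op (i := i.+1) (h, (x0, y0)) (h', (x0', y0'))) m m'))).
    by rewrite sum_delta_l.
  by apply: eq_bigr => y0' _; rewrite /c /f [y == _]eq_sym [y' == _]eq_sym /=; ring.
rewrite superop_sum // entry_mkop [RHS]pair_bigA; apply: eq_bigr => k _.
by rewrite mulrC.
Qed.

Lemma outcome_probE o :
  outcome_prob B o = Re (pairing (outcome_op o) (@bob_strat (last_round G).+1)).
Proof.
rewrite /outcome_prob; congr Re; rewrite tr_mulop.
have step := decomposes_step (leqnn _) (joint_state_decomposes (leqnn _)).
set n := last_round G in step *.
transitivity (\sum_(p' : Y n * Z n) \sum_(p : Y n * Z n) \sum_m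
    entry (meas G o) p' p * entry (final_state B) (p, m) (p', m)).
  rewrite [LHS]sum_prod; apply: eq_bigr => p' _.
  rewrite [LHS]exchange_big [LHS]sum_prod.
  apply: eq_bigr => p _; apply: eq_bigr => m _.
  transitivity (\sum_m' (m' == m)%:R *
      (entry (meas G o) p' p * entry (final_state B) (p, m) (p', m'))).
    apply: eq_bigr => m' _; rewrite /tensop entry_mkop /= [entry 1%:M _ _]mxE.
    by rewrite (inj_eq enum_rank_inj); ring.
  by rewrite sum_delta_l.
pose K := (hist n * X n)%type; pose M := bmem B n.+1.
pose g (k k' : K) (p p' : Y n * Z n) (m : M) : C :=
  entry (meas G o) p' p * (entry (alice_op k.1 k'.1) (k.2, p.2) (k'.2, p'.2) *
    entry (bob_op (i := n.+1) (k.1, (k.2, p.1)) (k'.1, (k'.2, p'.1))) m m).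
transitivity (\sum_p' \sum_p \sum_m \sum_k \sum_k' g k k' p p' m).
  apply: eq_bigr => p' _; apply: eq_bigr => p _; apply: eq_bigr => m _.
  case: p p' => [y z] [y' z']; rewrite step mulr_sumr; apply: eq_bigr => k _.
  by rewrite mulr_sumr.
transitivity (\sum_(u : hist n.+1) \sum_(u' : hist n.+1) \sum_z \sum_z' \sum_m
    g (u.1, u.2.1) (u'.1, u'.2.1) (u.2.2, z) (u'.2.2, z') m); last first.
  apply: eq_bigr => -[h [x y]] _; apply: eq_bigr => -[h' [x' y']] _ /=.
  rewrite mulr_suml; apply: eq_bigr => z _.
  rewrite mulr_suml; apply: eq_bigr => z' _.
  by rewrite /bob_strat tr_entry mulr_sumr; apply: eq_bigr => m _; rewrite /g mulrA.
rewrite !pair_bigA /=.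
rewrite (reindex (fun q : hist n.+1 * hist n.+1 * Z n * Z n * M =>
  let: (u, u', z, z', m) := q in
  ((u'.2.2, z'), (u.2.2, z), m, (u.1, u.2.1), (u'.1, u'.2.1)))) /=.
  by apply: eq_bigr => -[[[[[h [x y]] [h' [x' y']]] z] z'] m] _.
exists (fun q : (Y n * Z n) * (Y n * Z n) * M * K * K =>
  let: (p', p, m, k, k') := q in
  ((k.1, (k.2, p.1)), (k'.1, (k'.2, p'.1)), p.2, p'.2, m)).
  by move=> [[[[[h [x y]] [h' [x' y']]] z] z'] m].
by move=> [[[[[y' z'] [y z]] m] [h x]] [h' x']].
Qed.

End Transcript.

(** * Realization of strategies *)

Section Kraus.
Variable R : realType.
Local Notation C := R[i].
Implicit Types S T W : finType.

Definition conj_by S T (V : T -> S -> C) : superop R S T := fun A =>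
  mkop (fun t t' => \sum_s \sum_s' V t s * (V t' s')^* * entry A s s').

Lemma conj_by_channel S T (V : T -> S -> C) :
  (forall s s', \sum_t V t s * (V t s')^* = (s == s')%:R) -> channel (conj_by V).
Proof.
move=> hV; split=> [c A B|W A /psdE /pos_gram [K [a AE]]|A].
- apply/matrixP => i j; rewrite !mxE mulr_sumr -big_split; apply: eq_bigr => s _ /=.
  rewrite mulr_sumr -big_split; apply: eq_bigr => s' _ /=.
  by rewrite /entry !mxE; ring.
- apply/psd_mkop/gram_pos.
  exists K, (fun k u => \sum_s V u.1 s * a k (s, u.2)) => -[t w] [t' w'] /=.
  rewrite /conj_by entry_mkop.
  transitivity (\sum_s \sum_s' \sum_k V t s * (V t' s')^* * (a k (s, w) * (a k (s', w'))^*)).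
    apply: eq_bigr => s _; apply: eq_bigr => s' _.
    by rewrite entry_mkop AE mulr_sumr.
  under [LHS]eq_bigr => s _ do rewrite exchange_big.
  rewrite [LHS]exchange_big; apply: eq_bigr => k _ /=.
  rewrite rmorph_sum big_distrlr; apply: eq_bigr => s _; apply: eq_bigr => s' _ /=.
  by rewrite rmorphM /= mulrACA.
- rewrite !tr_entry /conj_by entry_mkop /= exchange_big; apply: eq_bigr => s _ /=.
  rewrite exchange_big /=.
  transitivity (\sum_s' (s' == s)%:R * entry A s s'); last by rewrite sum_delta_l.
  by apply: eq_bigr => s' _; rewrite -mulr_suml hV eq_sym.
Qed.

End Kraus.

(** * Positive definite strategies are realizable, and they are dense *)

Section Realization.
Variables (R : realType) (O : finType) (G : interaction R O).
Local Notation C := R[i].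
Local Notation Re := complex.Re.
Local Notation X := (amsg G).
Local Notation Y := (bmsg G).
Local Notation hist := (hist X Y).
Local Notation r := (last_round G).

(** Bob's memory after [i] rounds is the space of histories itself, holding the vector [a i |h>];
    causality of [J] makes the transition maps isometric. *)
Lemma pdef_strat_realizable (J : forall i, fop R (hist i)) :
  strat r.+1 J -> (forall i, (i <= r.+1)%N -> pdef (J i)) ->
  exists B : strategy G, @bob_strat _ _ _ B r.+1 = J r.+1.
Proof.
move=> [J0 _ Jt] Jp.
have hab i : exists ab : (hist i -> hist i -> C) * (hist i -> hist i -> C),
    (i <= r.+1)%N ->
    [/\ forall t t', J i t t' = \sum_k ab.1 k t * (ab.1 k t')^*,
      forall t t', \sum_k ab.2 t k * ab.1 k t' = (t == t')%:R
    & forall k k', \sum_t ab.1 k t * ab.2 t k' = (k == k')%:R].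
  (* The choice runs over all [i], so indices beyond the last round receive a dummy pair. *)
  have [hi|hi] := boolP (i <= r.+1)%N; last by exists (fun _ _ => 0, fun _ _ => 0).
  by have [a [b h]] := pdef_factor (Jp i hi); exists (a, b).
pose a i := (sval (cid (hab i))).1; pose b i := (sval (cid (hab i))).2.
have aJ i t t' : (i <= r.+1)%N -> J i t t' = \sum_k a i k t * (a i k t')^*.
  by move=> hi; rewrite /a; case: cid => ab /= /(_ hi) [].
have ba i t t' : (i <= r.+1)%N -> \sum_k b i t k * a i k t' = (t == t')%:R.
  by move=> hi; rewrite /a /b; case: cid => ab /= /(_ hi) [].
have ab i k k' : (i <= r.+1)%N -> \sum_t a i k t * b i t k' = (k == k')%:R.
  by move=> hi; rewrite /a /b; case: cid => ab' /= /(_ hi) [].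
clearbody a b.
(* [V i] undoes [a i] by its inverse, then writes out the columns of [a i.+1]. *)
pose V i (w : Y i * hist i.+1) (u : X i * hist i) : C :=
  \sum_h a i.+1 w.2 (h, (u.1, w.1)) * b i h u.2.
pose init : Op R (hist 0) := mkop (fun k k' => a 0%N k tt * (a 0%N k' tt)^*).
have hinit : density init.
  split.
    apply/psd_mkop/gram_pos; exists unit, (fun _ k => a 0%N k tt) => t t'.
    by rewrite sum_unit.
  by rewrite tr_entry entry_mkop -aJ.
have hV i : (i <= r)%N -> channel (conj_by (V i)).
  move=> hi; apply: conj_by_channel => -[x n] [x' n'].
  transitivity (\sum_h \sum_h' b i h n * (b i h' n')^* * tr_out (J i.+1) (h, x) (h', x')).
    transitivity (\sum_y \sum_k \sum_h \sum_h' b i h n * (b i h' n')^* *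
        (a i.+1 k (h, (x, y)) * (a i.+1 k (h', (x', y)))^*)).
      rewrite sum_prod; apply: eq_bigr => y _; apply: eq_bigr => k _.
      rewrite /V rmorph_sum big_distrlr; apply: eq_bigr => h _; apply: eq_bigr => h' _ /=.
      by rewrite rmorphM /=; ring.
    under eq_bigr => y _ do rewrite exchange_big.
    rewrite exchange_big; apply: eq_bigr => h _ /=.
    under eq_bigr => y _ do rewrite exchange_big.
    rewrite exchange_big; apply: eq_bigr => h' _ /=.
    rewrite /tr_out mulr_sumr; apply: eq_bigr => y _ /=.
    by rewrite aJ // mulr_sumr.
  rewrite Jt // /ext_in /= xpair_eqE -mulnb natrM.
  transitivity ((x == x')%:R *
      \sum_h \sum_h' \sum_k (a i k h * b i h n) * (a i k h' * b i h' n')^*).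
    rewrite mulr_sumr; apply: eq_bigr => h _; rewrite mulr_sumr; apply: eq_bigr => h' _.
    rewrite aJ ?(leq_trans hi) // mulrA [LHS]mulrC mulr_sumr; congr (_ * _).
    by apply: eq_bigr => k _; rewrite rmorphM /=; ring.
  congr (_ * _).
  under eq_bigr => h _ do rewrite exchange_big.
  rewrite exchange_big /=.
  transitivity (\sum_k (k == n)%:R * (k == n')%:R : C); last by rewrite sum_delta_l.
  apply: eq_bigr => k _.
  rewrite -[(k == n')%:R]conjC_nat -!ab ?(leq_trans hi) // rmorph_sum big_distrlr.
  by [].
pose B := Strategy hinit hV.
(* Bob's conditional operator stays rank one, and its trace is [J i h h']. *)
have hB i (h h' : hist i) k k' : (i <= r.+1)%N ->
    entry (bob_op B h h') k k' = a i k h * (a i k' h')^*.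
  elim: i h h' k k' => [[] [] k k' _|i IH [h [x y]] [h' [x' y']] k k' hi].
    by rewrite entry_mkop.
  have Va : forall x y k h, \sum_n V i (y, k) (x, n) * a i n h = a i.+1 k (h, (x, y)).
    move=> x1 y1 k1 h1.
    transitivity (\sum_h0 a i.+1 k1 (h0, (x1, y1)) * \sum_n b i h0 n * a i n h1).
      under [RHS]eq_bigr => h0 _ do rewrite mulr_sumr.
      rewrite exchange_big; apply: eq_bigr => n _ /=.
      by rewrite mulr_suml; apply: eq_bigr => h0 _; rewrite mulrA.
    by under eq_bigr => h0 _ do rewrite (ba _ _ _ (ltnW hi)); rewrite sum_delta_r.
  rewrite /= entry_mkop /conj_by entry_mkop.
  rewrite -!Va rmorph_sum /= sum_prod exchange_big big_distrl /=.
  apply: eq_bigr => n _.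
  transitivity (\sum_x1 (x1 == x)%:R *
      (V i (y, k) (x1, n) * a i n h *
       \sum_n' (V i (y', k') (x', n') * a i n' h')^*)); last by rewrite sum_delta_l.
  apply: eq_bigr => x1 _; rewrite sum_prod exchange_big mulr_sumr mulr_sumr /=.
  apply: eq_bigr => n' _.
  transitivity (\sum_x1' (x1' == x')%:R *
      ((x1 == x)%:R * (V i (y, k) (x1, n) * a i n h *
       (V i (y', k') (x1', n') * a i n' h')^*))); last by rewrite sum_delta_l.
  apply: eq_bigr => x1' _; rewrite entry_mkop /= (IH _ _ _ _ (ltnW hi)) rmorphM /=.
  by ring.
exists B; apply/funext => h; apply/funext => h'.
by rewrite /bob_strat tr_entry aJ //; apply: eq_bigr => k _; rewrite hB.
Qed.

Lemma quad_uniform i v : (forall j, (j < i)%N -> inhabited (Y j)) ->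
  (exists h, v h != 0) -> 0 < quad (@uniform R X Y i) v.
Proof.
move=> hY [h0 vh0].
have P0 : 0 < (\prod_(j < i) #|Y j|%:R)^-1 :> C.
  rewrite invr_gt0; apply: prodr_gt0 => j _; rewrite ltr0n.
  by have [y] := hY j (ltn_ord j); apply/card_gt0P; exists y.
have -> : quad (@uniform R X Y i) v = (\prod_(j < i) #|Y j|%:R)^-1 * \sum_h v h * (v h)^*.
  rewrite mulr_sumr; apply: eq_bigr => h _.
  transitivity (\sum_h' (h' == h)%:R * ((v h)^* * (\prod_(j < i) #|Y j|%:R)^-1 * v h')).
    by apply: eq_bigr => h' _; rewrite /uniform eq_sym; ring.
  by rewrite sum_delta_l; ring.
rewrite mulr_gt0 // (bigD1 h0) //= ltr_wpDr ?mul_conjC_gt0 //.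
by apply: sumr_ge0 => h _; apply: mul_conjC_ge0.
Qed.

(** Mixing with [uniform] at weight [e] gives a positive definite, hence realizable, strategy; the
    bound survives as [e] tends to 0. *)
Lemma strat_sup (F : fop R (hist r.+1)) v :
  (forall i, (i < r.+1)%N -> inhabited (Y i)) ->
  (forall B : strategy G, Re (pairing F (@bob_strat _ _ _ B r.+1)) <= v) ->
  forall J, strat r.+1 J -> Re (pairing F (J r.+1)) <= v.
Proof.
move=> hY hv J sJ.
have sU := @uniform_strat R X Y r.+1 hY.
set x := Re _; pose u := Re (pairing F (@uniform R X Y r.+1)).
have key e : 0 < e -> e < 1 -> (1 - e) * x + e * u <= v.
  move=> e0 e1; have e1' : 0 <= 1 - e by rewrite subr_ge0 ltW.
  pose K i : fop R (hist i) := lin (1 - e)%:C%C (J i) e%:C%C (@uniform R X Y i).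
  have Kp i : (i <= r.+1)%N -> pdef (K i).
    move=> hi w hw; rewrite quad_lin; apply: ltr_wpDl.
      apply: mulr_ge0; first by rewrite ler0c.
      by case: sJ => _ Jg _; apply: gram_pos; apply: Jg.
    rewrite mulr_gt0 ?ltr0c ?quad_uniform //.
      by rewrite ltcE /= eqxx.
    by move=> j ji; apply: hY; apply: leq_trans ji hi.
  have sK : strat r.+1 K.
    case: sJ sU => [J0 Jg Jt] [U0 Ug Ut]; split=> [|i hi|i hi].
    - by rewrite /K /lin J0 U0 !mulr1 -rmorphD /= subrK.
    - exact/pos_gram/pdef_pos/Kp.
    - by rewrite /K tr_out_lin ext_in_lin Jt // Ut.
  have [B hB] := pdef_strat_realizable sK Kp.
  have := hv B; rewrite hB /K pairingC pairing_linl ReD !ReZ.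
  by rewrite pairingC (pairingC _ F).
have [//|xv] := leP x v; exfalso.
pose d := x - v; have d0 : 0 < d by rewrite subr_gt0.
pose w := `|x - u|; have w0 : 0 <= w by apply: normr_ge0.
(* Chosen so that [e < 1] and [e * w < d]: the mixture then still exceeds [v]. *)
pose e := d / (d + w + 1).
have q0 : 0 < d + w + 1 by lra.
have e0 : 0 < e by rewrite divr_gt0.
have e1 : e < 1 by rewrite ltr_pdivrMr //; lra.
have := key e e0 e1.
have : e * (x - u) <= e * w by apply: ler_wpM2l; [exact: ltW|exact: ler_norm].
have : e * w < d.
  by rewrite /e mulrAC ltr_pdivrMr // ltr_pM2l //; lra.
rewrite /d; lra.
Qed.

End Realization.

(** * Parallel instances *)

Section GramProducts.
Variable R : realType.
Local Notation C := R[i].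
Local Notation Re := complex.Re.
Implicit Types T : finType.

Lemma gram_lin T a (F : fop R T) b G : 0 <= a -> 0 <= b ->
  gram F -> gram G -> gram (lin a F b G).
Proof.
move=> a0 b0 /gram_pos hF /gram_pos hG; apply: pos_gram => v.
by rewrite quad_lin addr_ge0 // mulr_ge0.
Qed.

Lemma gramD T (F G : fop R T) :
  gram F -> gram G -> gram (fun t t' => F t t' + G t t').
Proof.
move=> hF hG; apply: gram_eq (gram_lin ler01 ler01 hF hG) => t t'.
by rewrite /lin !mul1r.
Qed.

Lemma gramM T (F G : fop R T) :
  gram F -> gram G -> gram (fun t t' => F t t' * G t t').
Proof.
move=> [K [a FE]] [L [b GE]].
exists (K * L)%type, (fun k t => a k.1 t * b k.2 t) => t t'.
rewrite FE GE big_distrlr sum_prod; apply: eq_bigr => k _; apply: eq_bigr => l _ /=.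
by rewrite rmorphM /= mulrACA.
Qed.

Lemma gram_prod T (I : Type) (s : seq I) (F : I -> fop R T) :
  (forall i, gram (F i)) -> gram (fun t t' => \prod_(i <- s) F i t t').
Proof.
move=> hF; elim: s => [|i s IH].
  exists unit, (fun _ _ => 1) => t t'.
  by rewrite big_nil sum_unit conjC1 mulr1.
by apply: gram_eq (gramM (hF i) IH) => t t'; rewrite big_cons.
Qed.

(** Products of positive kernels are monotone: change one factor at a time, each difference being
    Gram by the Schur product theorem. *)
Lemma gram_prod_sub T (I : Type) (s : seq I) (F D : I -> fop R T) :
  (forall i, gram (F i)) -> (forall i, gram (D i)) ->
  gram (fun t t' => \prod_(i <- s) (F i t t' + D i t t') - \prod_(i <- s) F i t t').
Proof.
move=> hF hD; elim: s => [|i s IH].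
  exists void, (fun _ _ => 0) => t t'.
  by rewrite !big_nil subrr big1 // => -[].
have hP : gram (fun t t' => \prod_(i <- s) (F i t t' + D i t t')).
  by apply: (gram_prod s (F := fun i t t' => F i t t' + D i t t')) => j; apply: gramD.
apply: gram_eq (gramD (gramM (hD i) hP) (gramM (hF i) IH)) => t t'.
by rewrite !big_cons; ring.
Qed.

(** The Hermitian part, whose form is the real part of that of [F]. *)
Definition herm T (F : fop R T) : fop R T := fun t t' => 2^-1 * (F t t' + (F t' t)^*).

Lemma quad_herm T (F : fop R T) v : quad (herm F) v = (Re (quad F v))%:C%C.
Proof.
have -> : (Re (quad F v))%:C%C = 2^-1 * (quad F v + (quad F v)^*).
  by rewrite complexRe ReE mulrC.
have -> : (quad F v)^* = quad (fun t t' => (F t' t)^*) v.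
  rewrite /quad [RHS]exchange_big rmorph_sum; apply: eq_bigr => t _ /=.
  rewrite rmorph_sum; apply: eq_bigr => t' _ /=.
  by rewrite !rmorphM /= conjCK; ring.
have -> : herm F = lin 2^-1 F 2^-1 (fun t t' => (F t' t)^*).
  by apply/funext => t; apply/funext => t'; rewrite /herm /lin mulrDr.
by rewrite quad_lin mulrDr.
Qed.

Lemma gram_herm T (F : fop R T) : rpos F -> gram (herm F).
Proof. by move=> hF; apply: pos_gram => v; rewrite quad_herm ler0c. Qed.

Lemma herm_gram T (F : fop R T) : gram F -> herm F = F.
Proof.
move=> /gram_pos /pos_herm hF; apply/funext => t; apply/funext => t'.
by rewrite /herm (hF t t') conjCK -mulr2n -[F t t' *+ 2]mulr_natl mulKf // pnatr_eq0.
Qed.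

Lemma natr_ffun_eq (n : nat) (S : eqType) (f g : {ffun 'I_n -> S}) :
  (f == g)%:R = \prod_j (f j == g j)%:R :> C.
Proof.
case: eqP => [->|/eqP ne]; first by rewrite big1 // => j _; rewrite eqxx.
have [j] : exists j, f j != g j.
  apply/existsP; apply: contraNT ne; rewrite negb_exists => /forallP h.
  by apply/eqP/ffunP => j; have := h j; rewrite negbK => /eqP.
by move=> /negPf h; rewrite (bigD1 j) //= h mul0r.
Qed.

End GramProducts.

(** * Tensor powers of dual solutions *)

Section PowerDuality.
Variables (R : realType) (X Y : nat -> finType) (n : nat).
Local Notation C := R[i].
Local Notation Re := complex.Re.
Local Notation XP := (fun i => {ffun 'I_n -> X i} : finType).
Local Notation YP := (fun i => {ffun 'I_n -> Y i} : finType).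

Fixpoint hist_proj i (j : 'I_n) : hist XP YP i -> hist X Y i :=
  match i return hist XP YP i -> hist X Y i with
  | 0 => fun _ => tt
  | k.+1 => fun h => (hist_proj j h.1, (h.2.1 j, h.2.2 j))
  end.

Definition pow_op m (F : fop R (hist X Y m)) : fop R (hist XP YP m) :=
  fun h h' => \prod_j F (hist_proj j h) (hist_proj j h').

(** The dual program with genuinely positive slack: positivity of real parts alone does not survive
    products. *)
Fixpoint herm_dual_le m : fop R (hist X Y m) -> R -> Prop :=
  match m return fop R (hist X Y m) -> R -> Prop with
  | 0 => fun F c => Re (F tt tt) <= c
  | i.+1 => fun F c => exists Q : fop R (hist X Y i * X i)%type,
      gram (lin 1 (ext_out Q) (-1) F) /\ herm_dual_le (tr_in Q) c
  end.

(** Taking Hermitian parts commutes with [ext_out] and [tr_in]. *)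
Lemma dual_hermP m (F : fop R (hist X Y m)) c : dual_le F c -> herm_dual_le (herm F) c.
Proof.
elim: m F => [|m IH] F /=.
  move=> h; rewrite /herm; have -> : 2^-1 * (F tt tt + (F tt tt)^*) = (Re (F tt tt))%:C%C.
    by rewrite complexRe ReE mulrC.
  by [].
move=> [Q [hQ dQ]]; exists (herm Q); split.
  apply: gram_eq (gram_herm hQ) => t t'; rewrite /herm /lin /ext_out !mul1r.
  by rewrite rmorphD rmorphM rmorphM rmorphN1 /= conjC_nat [t'.2.2 == _]eq_sym; ring.
suff -> : tr_in (herm Q) = herm (tr_in Q) by apply: IH.
apply/funext => h; apply/funext => h'.
by rewrite /tr_in /herm rmorph_sum -big_split mulr_sumr.
Qed.

(** Positivity of [F] and of the slack makes [Q] positive, so taking powers preserves the domination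
    of [F] by [ext_out Q], and the argument descends to [tr_in Q]. *)
Lemma dual_herm_pow m (F : fop R (hist X Y m)) c :
  (forall i, (i < m)%N -> inhabited (Y i)) ->
  gram F -> herm_dual_le F c -> dual_le (pow_op F) (c ^+ n).
Proof.
elim: m F => [|m IH] F hY gF /=.
  move=> hc; have F0 : 0 <= F tt tt.
    have [K [a ->]] := gF; apply: sumr_ge0 => k _; exact: mul_conjC_ge0.
  rewrite /pow_op /= prodr_const card_ord.
  have -> : F tt tt = (Re (F tt tt))%:C%C by rewrite RRe_real // ger0_real.
  rewrite -rmorphXn /=; have := Re_ge0 F0 => R0.
  by apply: lerXn2r => //; rewrite nnegrE // (le_trans R0).
move=> [Q [gD dQ]]; set D := lin _ _ _ _ in gD.
have extE t t' : ext_out Q t t' = F t t' + D t t' by rewrite /D /lin; ring.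
have [y0] := hY m (ltnSn m).
have gQ : gram Q.
  (* [Q] is the block of [ext_out Q] at the fixed answer [y0]. *)
  apply: gram_eq (gram_comp (fun u => (u.1, (u.2, y0))) (gramD gF gD)) => -[h x] [h' x'].
  by rewrite -extE /ext_out /= eqxx mulr1.
pose QP : fop R (hist XP YP m * XP m)%type := fun u u' =>
  \prod_j Q (hist_proj j u.1, u.2 j) (hist_proj j u'.1, u'.2 j).
exists QP; split.
  pose Fj (j : 'I_n) : fop R (hist XP YP m.+1) :=
    fun t t' => F (hist_proj j t) (hist_proj j t').
  pose Dj (j : 'I_n) : fop R (hist XP YP m.+1) :=
    fun t t' => D (hist_proj j t) (hist_proj j t').
  suff : gram (lin 1 (ext_out QP) (-1) (pow_op F)).
    by move=> /gram_pos h v; apply: Re_ge0; apply: h.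
  have gFj j : gram (Fj j) by apply: gram_comp.
  have gDj j : gram (Dj j) by apply: gram_comp.
  apply: gram_eq (gram_prod_sub (index_enum 'I_n) gFj gDj) => t t'.
  rewrite /lin mul1r mulN1r; congr (_ - _).
  rewrite /ext_out /QP natr_ffun_eq -big_split; apply: eq_bigr => j _ /=.
  by rewrite /Fj /Dj -extE.
suff -> : tr_in QP = pow_op (tr_in Q).
  apply: IH => // [i im|]; first by apply: hY; apply: leqW.
  exact: gram_tr.
apply/funext => h; apply/funext => h'.
by rewrite /tr_in /QP /pow_op bigA_distr_bigA.
Qed.

Lemma dual_pow m (F : fop R (hist X Y m)) c :
  (forall i, (i < m)%N -> inhabited (Y i)) ->
  gram F -> dual_le F c -> dual_le (pow_op F) (c ^+ n).
Proof.
move=> hY gF /dual_hermP; rewrite (herm_gram gF); exact: dual_herm_pow.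
Qed.

(** Functions on an empty index set form a point even if the single-instance alphabets are empty, so
    the constant 1 is a dual solution. *)
Lemma dual_pow0 m (F : fop R (hist X Y m)) : n = 0%N -> dual_le (pow_op F) 1.
Proof.
move=> n0; have -> : pow_op F = fun _ _ => 1.
  apply/funext => h; apply/funext => h'; rewrite /pow_op big1 // => j _.
  by have := ltn_ord j; rewrite [X in (_ < X)%N]n0.
elim: m {F} => [|m IH] /=; first exact: lexx.
have uniq_ffun (T : finType) (f g : {ffun 'I_n -> T}) : f = g.
  by apply/ffunP => j; have := ltn_ord j; rewrite [X in (_ < X)%N]n0.
exists (fun _ _ => 1); split.
  move=> v; rewrite (_ : lin _ _ _ _ = fun _ _ => 0) ?quad0 //.
  apply/funext => t; apply/funext => t'.
  by rewrite /lin /ext_out (uniq_ffun _ t.2.2 t'.2.2) eqxx mulr1n; ring.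
suff -> : tr_in (X := XP m) (fun _ _ => 1) = (fun _ _ => 1 : C)
    :> fop R (hist XP YP m) by [].
apply/funext => h; apply/funext => h'.
by rewrite /tr_in sumr_const card_ffun card_ord [X in (_ ^ X)%N]n0 expn0.
Qed.

End PowerDuality.

(** * Alice's operators in the parallel game are products *)

Section Parallel.
Variables (R : realType) (O : finType) (G : interaction R O) (n : nat).
Hypothesis hG : valid_interaction G.
Local Notation C := R[i].
Local Notation GP := (parallel n G).

Lemma sum_instance (S T : finType) (f : 'I_n -> S * T -> C) :
  \sum_v \prod_j f j (instance j v) = \prod_j \sum_s f j s.
Proof.
rewrite bigA_distr_bigA /=.
rewrite (reindex (fun v : {ffun 'I_n -> S} * {ffun 'I_n -> T} =>
  [ffun j => instance j v])) /=.
  by apply: eq_bigr => v _; apply: eq_bigr => j _; rewrite ffunE.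
exists (fun f : {ffun 'I_n -> S * T} => ([ffun j => (f j).1], [ffun j => (f j).2])).
  move=> [v w] _; congr (_, _); apply/ffunP => j; rewrite !ffunE //.
by move=> g _; apply/ffunP => j; rewrite ffunE /instance /= !ffunE; case: (g j).
Qed.

Lemma superop_unitop (S T : finType) (F : superop R S T) (f : fop R S) t t' :
  linear F ->
  entry (F (mkop f)) t t' = \sum_s \sum_s' f s s' * entry (F (unitop R s s')) t t'.
Proof.
move=> hF.
pose c (k : S * S) := f k.1 k.2.
pose g (k : S * S) : fop R S := fun s s' => (s == k.1)%:R * (s' == k.2)%:R.
have fE : f = (fun s s' => \sum_k c k * g k s s').
  apply/funext => s; apply/funext => s'; rewrite sum_prod.
  transitivity (\sum_s0 (s0 == s)%:R * f s0 s'); first by rewrite sum_delta_l.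
  apply: eq_bigr => s0 _.
  transitivity (\sum_s0' (s0' == s')%:R * ((s0 == s)%:R * f s0 s0')).
    by rewrite sum_delta_l.
  by apply: eq_bigr => s0' _; rewrite /c /g /= [s == _]eq_sym [s' == _]eq_sym; ring.
rewrite {1}fE superop_sum // entry_mkop sum_prod.
apply: eq_bigr => s _; apply: eq_bigr => s' _.
have -> : mkop (g (s, s')) = unitop R s s'.
  apply/matrixP => i j; rewrite !mxE /g /= -natrM mulnb.
  by rewrite !(can2_eq enum_valK enum_rankK).
by [].
Qed.

(** Given the histories, the copies are independent. Expanding in matrix units, as [superop_pow]
    does, turns the joint sum into a product of sums. *)
Lemma alice_op_parallel i (h h' : hist (amsg GP) (bmsg GP) i) u u' :
  (i <= last_round G)%N ->
  entry (alice_op (G := GP) h h') u u' =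
  \prod_j entry (alice_op (G := G) (hist_proj j h) (hist_proj j h'))
    (instance j u) (instance j u').
Proof.
elim: i h h' u u' => [|i IH] h h' u u' hi; first by rewrite /= entry_mkop.
have [_ hresp _] := hG; have [hlin _ _] := hresp i hi.
rewrite /= /superop_pow entry_mkop.
pose f (j : 'I_n) : fop R (bmsg G i * amem G i)%type := fun s s' =>
  (s.1 == h.2.2 j)%:R * (s'.1 == h'.2.2 j)%:R *
  entry (alice_op (hist_proj j h.1) (hist_proj j h'.1)) (h.2.1 j, s.2) (h'.2.1 j, s'.2).
transitivity (\sum_v \sum_v' \prod_j (f j (instance j v) (instance j v') *
    entry (resp G i (unitop R (instance j v) (instance j v')))
      (instance j u) (instance j u'))).
  apply: eq_bigr => v _; apply: eq_bigr => v' _.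
  rewrite entry_mkop (IH _ _ _ _ (ltnW hi)) !natr_ffun_eq -!big_split.
  by apply: eq_bigr => j _.
transitivity (\sum_v \prod_j \sum_s' (f j (instance j v) s' *
    entry (resp G i (unitop R (instance j v) s')) (instance j u) (instance j u'))).
  apply: eq_bigr => v _.
  by rewrite (sum_instance (fun j s' => f j (instance j v) s' *
    entry (resp G i (unitop R (instance j v) s')) (instance j u) (instance j u'))).
rewrite (sum_instance (fun j s => \sum_s' (f j s s' *
    entry (resp G i (unitop R s s')) (instance j u) (instance j u')))).
by apply: eq_bigr => j _; rewrite superop_unitop.
Qed.

Lemma outcome_op_parallel (o : {ffun 'I_n -> O}) h h' :
  outcome_op (G := GP) o h h' =
  \prod_j outcome_op (G := G) (o j) (hist_proj j h) (hist_proj j h').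
Proof.
rewrite /outcome_op.
under [RHS]eq_bigr => j _ do rewrite pair_bigA.
rewrite bigA_distr_bigA pair_bigA /=.
pose Z := amem G (last_round G).
rewrite [RHS](reindex (fun v : {ffun 'I_n -> Z} * {ffun 'I_n -> Z} =>
  [ffun j => instance j v])) /=.
  apply: eq_bigr => -[z z'] _; rewrite entry_mkop alice_op_parallel // -big_split.
  by apply: eq_bigr => j _; rewrite ffunE.
exists (fun f : {ffun 'I_n -> _ * _} => ([ffun j => (f j).1], [ffun j => (f j).2])).
  move=> [v w] _; congr (_, _); apply/ffunP => j; rewrite !ffunE //.
by move=> g _; apply/ffunP => j; rewrite ffunE /instance /= !ffunE; case: (g j).
Qed.

End Parallel.

(** * The moment generating function of a Bernoulli variable *)

Section Hoeffding.
Variable R : realType.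

Lemma ge0_derive_ge0 (f df : R -> R) :
  (forall x : R, is_derive x 1 f (df x)) -> (forall x, 0 <= x -> 0 <= df x) ->
  forall x, 0 <= x -> f 0 <= f x.
Proof.
move=> hf hdf x x0.
have [c|c + /eqP] := MVT_segment x0 (fun y _ => hf y).
  by apply: derivable_within_continuous => y _; case: (hf y).
rewrite in_itv /= => /andP[c0 _]; rewrite subr0 subr_eq => /eqP ->.
by rewrite lerDr mulr_ge0 // hdf.
Qed.

Variable p : R.
Hypotheses (p0 : 0 <= p) (p1 : p <= 1).

Let D (t : R) : R := (1 - p) + p * expR t.

Let D_gt0 t : 0 < D t.
Proof.
rewrite /D; have := expR_gt0 t => e0.
have [->|pn] := eqVneq p 0; first by rewrite subr0 mul0r addr0.
by apply: ltr_wpDl; rewrite ?subr_ge0 // mulr_gt0 // lt0r pn.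
Qed.

Let dD (t : R) : is_derive t 1 D (p * expR t).
Proof.
have h := is_deriveD (is_derive_cst (1 - p) t 1) (is_deriveZ p (is_derive_expR t)).
by apply: is_derive_eq h _; rewrite add0r.
Qed.

(** The derivative of [p t + t^2 / 8 - ln (D t)], with [D' / D] written as [1 - (1 - p) / D]. *)
Let h (t : R) : R := (p - 1 + 4^-1 * t) + (1 - p) * (D t)^-1.

Let dh (t : R) : is_derive t 1 h (4^-1 - (1 - p) * (D t ^- 2 * (p * expR t))).
Proof.
have hl := is_deriveD (is_derive_cst (p - 1) t 1) (is_deriveZ 4^-1 (is_derive_id t 1)).
have hv := is_deriveZ (1 - p) (is_deriveV (lt0r_neq0 (D_gt0 t)) (dD t)).
apply: is_derive_eq (is_deriveD hl hv) _.
by rewrite add0r /GRing.scale /=; ring.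
Qed.

Let h_ge0 t : 0 <= t -> 0 <= h t.
Proof.
move=> t0; have h0 : h 0 = 0 by rewrite /h /D expR0; field; lra.
rewrite -h0; apply: (ge0_derive_ge0 dh) => // x _.
have := D_gt0 x => Dx; rewrite subr_ge0 mulrCA ler_pdivrMl ?exprn_gt0 //.
have e0 := expR_gt0 x; rewrite /D.
(* AM-GM: [4 (1 - p) p e^x <= (D x)^2]. *)
have := sqr_ge0 ((1 - p) - p * expR x); lra.
Qed.

Let E (t : R) : R := expR (- (p * t) - 8^-1 * t ^+ 2).

Let dE (t : R) : is_derive t 1 E (E t * (- p - 4^-1 * t)).
Proof.
have hq := is_deriveD (is_deriveN (is_deriveZ p (is_derive_id t 1)))
  (is_deriveN (is_deriveZ 8^-1 (is_deriveX 2 (is_derive_id t 1)))).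
apply: is_derive_eq (is_derive1_comp (is_derive_expR _) hq) _.
by rewrite /E /GRing.scale /=; congr (_ * _); field.
Qed.

Lemma bernoulli_mgf t : 0 <= t -> 1 - p + p * expR t <= expR (p * t + 8^-1 * t ^+ 2).
Proof.
move=> t0; rewrite -/(D t).
(* The claim is [D E <= 1], an equality at 0; [g] is nondecreasing because its derivative is
   [E D h]. *)
pose g (x : R) : R := - (D x * E x).
have dg (x : R) : is_derive x 1 g (E x * D x * h x).
  apply: is_derive_eq (is_deriveN (is_deriveM (dD x) (dE x))) _.
  have Dh : D x * h x = D x * (p + 4^-1 * x) - p * expR x.
    by rewrite /h mulrDr mulrCA mulfV ?lt0r_neq0 // mulr1 /D; ring.
  by rewrite -mulrA Dh /GRing.scale /=; ring.
have : g 0 <= g t.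
  apply: (ge0_derive_ge0 dg) => // x x0.
  by rewrite mulr_ge0 ?h_ge0 // mulr_ge0 ?expR_ge0 // ltW.
have E0 : D 0 * E 0 = 1.
  by rewrite /D /E expr0n !mulr0 !oppr0 addr0 expR0 !mulr1 subrK.
by rewrite /g lerN2 E0 /E -opprD expRN ler_pdivrMr ?expR_gt0 // mul1r.
Qed.

End Hoeffding.

(** * The tail bound *)

Section Values.
Variables (R : realType) (O : finType) (G : interaction R O).
Hypothesis hG : valid_interaction G.
Local Notation C := R[i].
Local Notation Re := complex.Re.
Local Notation r := (last_round G).

Lemma resp_linear_valid i : (i < r)%N -> linear (resp G i).
Proof. by have [_ h _] := hG; move=> /h []. Qed.

Lemma gram_rpos (T : finType) (F : fop R T) : gram F -> rpos F.
Proof. by move=> /gram_pos h v; apply: Re_ge0. Qed.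

(** Alice's trace preservation gives the form [ext_out Q], and Bob's causality then removes one
    round. *)
Lemma pairing_alice_bob (B : strategy G) i : (i <= r)%N ->
  pairing (fun h h' => \tr (alice_op h h')) (@bob_strat _ _ _ B i) = 1.
Proof.
have [[_ trrho] hresp _] := hG; have [T0 _ Tt] := bob_strat_strat B.
elim: i => [|i IH] hi; first by rewrite pairing_unit T0 mulr1.
have [_ _ htp] := hresp i hi.
pose Q : fop R (hist (amsg G) (bmsg G) i * amsg G i)%type := fun u u' =>
  \sum_z entry (alice_op u.1 u'.1) (u.2, z) (u'.2, z).
have -> : (fun h h' : hist (amsg G) (bmsg G) i.+1 => \tr (alice_op h h')) = ext_out Q.
  apply/funext => -[h [x y]]; apply/funext => -[h' [x' y']].
  rewrite /= htp tr_entry sum_prod /ext_out /Q /=.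
  rewrite exchange_big mulr_suml; apply: eq_bigr => z _ /=.
  under eq_bigr do rewrite entry_mkop /= -mulrA.
  by rewrite sum_delta_l mulrC.
rewrite pairing_ext_out Tt ?ltnS ?(ltnW hi) // pairing_ext_in -[RHS](IH (ltnW hi)).
congr pairing; apply/funext => h; apply/funext => h'.
by rewrite tr_entry sum_prod.
Qed.

Lemma sum_outcome_op (h h' : hist (amsg G) (bmsg G) r.+1) :
  \sum_o outcome_op o h h' = ext_out (fun u u' =>
    \sum_z entry (alice_op u.1 u'.1) (u.2, z) (u'.2, z)) h h'.
Proof.
have [_ _ [_ hm]] := hG; case: h h' => [h [x y]] [h' [x' y']].
have mE u u' : \sum_o entry (meas G o) u u' = (u == u')%:R.
  rewrite -[RHS]/((_ == _)%:R) -(inj_eq enum_rank_inj).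
  have := congr1 (fun A : Op R _ => A (enum_rank u) (enum_rank u')) hm.
  by rewrite summxE mxE.
rewrite /outcome_op exchange_big /ext_out /= mulr_suml; apply: eq_bigr => z _ /=.
rewrite exchange_big /=.
transitivity (\sum_z' (z' == z)%:R * ((y == y')%:R * entry (alice_op h h') (x, z) (x', z'))).
  apply: eq_bigr => z' _; rewrite -mulr_suml mE xpair_eqE [y' == _]eq_sym.
  by rewrite -mulnb natrM; ring.
by rewrite sum_delta_l mulrC.
Qed.

Lemma outcome_prob_ge0 (B : strategy G) o : 0 <= outcome_prob B o.
Proof.
rewrite (outcome_probE _ resp_linear_valid); apply: pairing_rpos.
  exact/gram_rpos/gram_outcome_op.
by have [_ h _] := bob_strat_strat B; apply: h.
Qed.

Lemma pairing_suml (T I : finType) (F : I -> fop R T) (J : fop R T) (c : I -> C) :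
  pairing (fun t t' => \sum_i c i * F i t t') J = \sum_i c i * pairing (F i) J.
Proof.
rewrite /pairing; under [RHS]eq_bigr do rewrite mulr_sumr.
rewrite [RHS]exchange_big; apply: eq_bigr => t _ /=.
under [RHS]eq_bigr do rewrite mulr_sumr.
rewrite [RHS]exchange_big; apply: eq_bigr => t' _ /=.
by rewrite mulr_suml; apply: eq_bigr => i _; rewrite mulrA.
Qed.

Lemma sum_outcome_prob (B : strategy G) : \sum_o outcome_prob B o = 1.
Proof.
under eq_bigr do rewrite (outcome_probE _ resp_linear_valid).
rewrite -Re_sum.
transitivity (Re (1 : C)) => //; congr Re.
transitivity (pairing (fun h h' => \sum_o 1 * outcome_op o h h')
  (@bob_strat _ _ _ B r.+1)).
  by rewrite pairing_suml; apply: eq_bigr => o _; rewrite mul1r.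
under eq_fun => h do under eq_fun => h' do under eq_bigr do rewrite mul1r.
under eq_fun => h do under eq_fun => h' do rewrite sum_outcome_op.
have [T0 _ Tt] := bob_strat_strat B.
rewrite pairing_ext_out Tt // pairing_ext_in -[RHS](pairing_alice_bob B (leqnn r)).
congr pairing; apply/funext => h; apply/funext => h'.
by rewrite tr_entry sum_prod.
Qed.

(** Realizing [uniform] shows that the supremum defining the optimal probability is over a nonempty
    set. *)
Lemma strategy_exists : (forall i, (i < r.+1)%N -> inhabited (bmsg G i)) ->
  exists B : strategy G, True.
Proof.
move=> hY; have [|B _] := pdef_strat_realizable (uniform_strat R (amsg G) hY).
  by move=> i hi v hv; apply: quad_uniform => // j ji; apply: hY; apply: leq_trans hi.
by exists B.
Qed.

End Values.

(** * Generating function of the number of wins *)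

Section ParallelValues.
Variables (R : realType) (n : nat).
Local Notation C := R[i].
Local Notation Re := complex.Re.

Lemma superop_pow_linear (S T U W : finType) (F : superop R (S * T) (U * W)) :
  linear (superop_pow (n := n) F).
Proof.
move=> a A B; apply/matrixP => i j; rewrite !mxE mulr_sumr -big_split.
apply: eq_bigr => v _ /=; rewrite mulr_sumr -big_split; apply: eq_bigr => v' _ /=.
by rewrite /entry !mxE; ring.
Qed.

Lemma tr1_inhabited (T : finType) (A : Op R T) : \tr A = 1 -> inhabited T.
Proof.
move=> trA; apply: contrapT => hT; move/eqP: trA; rewrite tr_entry big1.
  by rewrite eq_sym oner_eq0.
by move=> t _; exfalso; apply: hT.
Qed.

(** Label types may be empty, so points come from nonzero traces: Alice's channels yield questions,
    Bob's causality yields answers, and one instance is projected out. *)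
Lemma messages_inhabited (O : finType) (G : interaction R O)
    (B : strategy (parallel n G)) i :
  (0 < n)%N -> valid_interaction G -> (i <= last_round G)%N ->
  inhabited (amsg G i) /\ inhabited (bmsg G i).
Proof.
move=> n0 [[_ trrho] hresp _].
have [T0 _ Tt] := bob_strat_strat B.
pose T := @bob_strat _ _ _ B; pose j0 := Ordinal n0.
have step k : (k <= last_round G)%N -> inhabited (amsg G k) ->
    (exists h, T k h h != 0) -> inhabited (bmsg G k) /\ exists h, T k.+1 h h != 0.
  move=> hk [x] [h hh].
  have := Tt k hk => /(congr1 (fun f => f (h, [ffun=> x]) (h, [ffun=> x]))).
  rewrite /tr_out /ext_in /= eqxx mulr1 => sE.
  have [y hy] : exists y, T k.+1 (h, ([ffun=> x], y)) (h, ([ffun=> x], y)) != 0.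
    apply: contrapT => hn; move/negP: hh; apply; rewrite /T -sE big1 // => y _.
    by apply: contrapT => /eqP hy; apply: hn; exists y.
  by split; [apply: (inhabits ((y : {ffun _ -> _}) j0))|exists (h, ([ffun=> x], y))].
suff main k : (k <= last_round G)%N ->
    inhabited (amsg G k * amem G k) /\ exists h, T k h h != 0.
  move=> hi; have [[[x z]] hT] := main i hi.
  by split=> //; have [] := step i hi (inhabits x) hT.
elim: k => [|k IH] hk.
  split; first exact: tr1_inhabited trrho.
  by exists tt; rewrite /T T0 oner_neq0.
have [[[x z]] hT] := IH (ltnW hk).
have [[y] hT'] := step k (ltnW hk) (inhabits x) hT.
split=> //; have [_ _ htp] := hresp k hk.
(* The projector on [(y, z)] has trace 1, and so does its image. *)
apply: (tr1_inhabited (A := resp G k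
  (mkop (fun u u' => (u == (y, z))%:R * (u' == (y, z))%:R)))).
by rewrite htp tr_entry entry_mkop sum_delta_l eqxx.
Qed.

Variables (G : interaction R bool).
Hypothesis hG : valid_interaction G.
Local Notation GP := (parallel n G).
Local Notation r := (last_round G).

Definition payoff (w : R) : fop R (hist (amsg G) (bmsg G) r.+1) :=
  lin 1 (outcome_op (G := G) false) w%:C%C (outcome_op (G := G) true).

Lemma parallel_linear i : (i < last_round GP)%N -> linear (resp GP i).
Proof. by move=> _; apply: superop_pow_linear. Qed.

(** Positivity comes from the product form of the outcome operators, so linearity is all that is
    asked of Alice's tensor-power maps. *)
Lemma parallel_outcome_prob_ge0 (B : strategy GP) o : 0 <= outcome_prob B o.
Proof.
rewrite (outcome_probE _ parallel_linear); apply: pairing_rpos; last first.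
  by have [_ h _] := bob_strat_strat B; apply: h.
apply: gram_rpos; have h := gram_prod (index_enum 'I_n)
  (F := fun j (t t' : hist (amsg GP) (bmsg GP) r.+1) =>
     outcome_op (G := G) (o j) (hist_proj j t) (hist_proj j t')).
apply: gram_eq (h _) => [t t'|j]; first by rewrite outcome_op_parallel.
by apply: gram_comp; apply: gram_outcome_op.
Qed.

(** Distributivity expands the tensor power of the payoff over all outcome strings, with one factor
    [w] per win. *)
Lemma parallel_mgf (B : strategy GP) w :
  \sum_(o : {ffun 'I_n -> bool}) w ^+ #|[set i | o i]| * outcome_prob B o =
  Re (pairing (pow_op (payoff w) : fop R (hist (amsg GP) (bmsg GP) r.+1))
    (@bob_strat _ _ _ B r.+1)).
Proof.
have -> : (pow_op (payoff w) : fop R (hist (amsg GP) (bmsg GP) r.+1)) =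
    (fun h h' => \sum_(o : {ffun 'I_n -> bool})
       (w ^+ #|[set i | o i]|)%:C%C * outcome_op (G := GP) o h h').
  apply/funext => h; apply/funext => h'.
  transitivity (\prod_(j < n) \sum_(b : bool) (if b then w%:C%C else 1) *
      outcome_op (G := G) b (hist_proj j h) (hist_proj j h')).
    by apply: eq_bigr => j _; rewrite big_bool /payoff /lin addrC.
  rewrite bigA_distr_bigA; apply: eq_bigr => o _.
  rewrite big_split outcome_op_parallel //=; congr (_ * _).
  rewrite -big_mkcond prodr_const rmorphXn /=; congr (_ ^+ _).
  by apply: eq_card => j; rewrite !inE.
rewrite pairing_suml Re_sum; apply: eq_bigr => o _.
by rewrite ReZ (outcome_probE _ parallel_linear).
Qed.

(** Markov's inequality for [w] raised to the number of wins. *)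
Lemma prob_at_least_mgf (B : strategy GP) k w : 1 <= w ->
  prob_at_least_wins B k * w ^+ k <=
    \sum_(o : {ffun 'I_n -> bool}) w ^+ #|[set i | o i]| * outcome_prob B o.
Proof.
move=> w1; rewrite /prob_at_least_wins mulr_suml.
rewrite [leRHS](bigID (fun o : {ffun 'I_n -> bool} => (k <= #|[set i | o i]|)%N)) /=.
rewrite ler_wpDr //.
  apply: sumr_ge0 => o _; apply: mulr_ge0; last exact: parallel_outcome_prob_ge0.
  by rewrite exprn_ge0 // (le_trans ler01).
apply: ler_sum => o hk; rewrite mulrC; apply: ler_wpM2r.
  exact: parallel_outcome_prob_ge0.
exact: ler_weXn2l.
Qed.

Local Notation p := (optimal_win_prob G).

Lemma optimal_win_prob_props :
  (forall i, (i < r.+1)%N -> inhabited (bmsg G i)) ->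
  [/\ 0 <= p, p <= 1 & forall B : strategy G, outcome_prob B true <= p].
Proof.
move=> hY; have [B0 _] := strategy_exists hY.
have q1 (B : strategy G) : outcome_prob B true <= 1.
  rewrite -(sum_outcome_prob hG B) big_bool /= lerDl; exact: outcome_prob_ge0.
have hp (B : strategy G) : outcome_prob B true <= p.
  by apply: ub_le_sup; [exists 1 => _ [B' ->]; exact: q1|exists B].
split=> //; first exact: le_trans (outcome_prob_ge0 hG B0 true) (hp B0).
apply: ge_sup; first by exists (outcome_prob B0 true), B0.
by move=> _ [B ->]; exact: q1.
Qed.

Lemma parallel_mgf_le (B : strategy GP) w e :
  (0 < n)%N -> 1 <= w -> 0 < e ->
  \sum_(o : {ffun 'I_n -> bool}) w ^+ #|[set i | o i]| * outcome_prob B o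
    <= (1 - p + p * w + e) ^+ n.
Proof.
move=> n0 w1 e0.
have hX i : (i < r.+1)%N -> inhabited (amsg G i).
  by rewrite ltnS => hi; have [] := messages_inhabited B n0 hG hi.
have hY i : (i < r.+1)%N -> inhabited (bmsg G i).
  by rewrite ltnS => hi; have [] := messages_inhabited B n0 hG hi.
have [p0 p1 hp] := optimal_win_prob_props hY.
have gF : gram (payoff w).
  apply: gram_lin; rewrite ?ler01 ?ler0c ?(le_trans ler01) //.
  - exact: gram_outcome_op.
  - exact: gram_outcome_op.
have hv (B' : strategy G) :
    Re (pairing (payoff w) (@bob_strat _ _ _ B' r.+1)) <= 1 - p + p * w.
  rewrite /payoff pairing_linl ReD mul1r ReZ -!(outcome_probE _ (resp_linear_valid hG)).
  (* The expected payoff is [1 + (w - 1)] times the winning probability, with 1 added once, and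
     [w >= 1]. *)
  have := sum_outcome_prob hG B'; rewrite big_bool /= => hs.
  have hq : outcome_prob B' true * (w - 1) <= p * (w - 1).
    by rewrite ler_wpM2r ?subr_ge0.
  lra.
have dF := strong_duality hX hY (strat_sup hY hv) e0.
rewrite parallel_mgf; apply: weak_duality; first exact: bob_strat_strat.
exact: (dual_pow n hY gF dF).
Qed.

End ParallelValues.
Theorem theorem3 (R : realType) (G : interaction R bool)
    (hG : valid_interaction G) (n k : nat) (delta : R) (hdelta : 0 < delta)
    (hk : k%:R = n%:R * (optimal_win_prob G + delta))
    (B : strategy (parallel n G)) :
  prob_at_least_wins B k <= expR (- (2 * n%:R * delta ^+ 2)).
Proof.
have [n0|n0] := posnP n.
  (* For [n = 0] the bound is 1, obtained by weak duality at [w = 1]. *)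
  have := prob_at_least_mgf hG B k (lexx 1); rewrite expr1n mulr1 => /le_trans; apply.
  rewrite parallel_mgf // [X in _ * X * _](_ : n%:R = 0) ?n0 // mulr0 mul0r oppr0 expR0.
  apply: weak_duality; first exact: bob_strat_strat.
  exact: dual_pow0.
set p := optimal_win_prob G in hk.
have hY i : (i < (last_round G).+1)%N -> inhabited (bmsg G i).
  by rewrite ltnS => hi; have [] := messages_inhabited B n0 hG hi.
have [p0 p1 _] := optimal_win_prob_props hG hY; rewrite -/p in p0 p1.
(* The minimizer of [t^2 / 8 - t delta], with minimum [-2 delta^2]. *)
pose t := 4 * delta; have t0 : 0 < t by rewrite mulr_gt0.
have w1 : 1 <= expR t by rewrite -expR0 ler_expR ltW.
pose x := p * t + 8^-1 * t ^+ 2.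
set P := prob_at_least_wins B k.
have nR : 0 < n%:R :> R by rewrite ltr0n.
(* The duality gap is taken to be exactly the distance from the generating function up to
   [expR (x + eta)], so the bound remains a pure exponential. *)
have key eta : 0 < eta -> P * expR (t * k%:R) <= expR (n%:R * (x + eta)).
  move=> eta0; have := bernoulli_mgf p0 p1 (ltW t0); rewrite -/x => hx.
  have e0 : 0 < expR (x + eta) - (1 - p + p * expR t).
    by rewrite subr_gt0; apply: le_lt_trans hx _; rewrite ltr_expR ltrDl.
  have := le_trans (prob_at_least_mgf hG B k w1) (parallel_mgf_le hG B n0 w1 e0).
  by rewrite -/p -/P addrC subrK -!expRM_natl [k%:R * t]mulrC.
have [P0|P0] := leP P 0; first exact: le_trans P0 (expR_ge0 _).
have lnP : ln P + t * k%:R <= n%:R * x.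
  (* After taking logarithms, [eta = e / n] costs only [e], which is arbitrary. *)
  apply/ler_addgt0Pr => e e0.
  have := key (e / n%:R) (divr_gt0 e0 nR).
  rewrite -{1}(lnK P0) -expRD ler_expR mulrDr mulrCA divff ?lt0r_neq0 //.
  by rewrite mulr1.
rewrite -(lnK P0) ler_expR; move: lnP; rewrite hk /x /t => lnP.
have -> : - (2 * n%:R * delta ^+ 2) =
  n%:R * (p * (4 * delta) + 8^-1 * (4 * delta) ^+ 2) - 4 * delta * (n%:R * (p + delta)).
  by field.
by rewrite lerBrDr.
Qed.
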